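(* The fundamental solution of the operator $\partial_t^2-2\partial_t\partial_{x_1}-x_1^2\partial_{x_2}^2$ on $]0,+\infty[\times\mathbb{R}^2$ is given, for every parameter $y_1\in\mathbb{R}$, by $$\Gamma(t,x_1,y_1,x_2)=\frac{\sqrt3}{2\pi}\,\frac{1}{\sqrt{(y_1^3-x_1^3)(2t+x_1-y_1)-3x_2^2}}$$ if $t>0$, $y_1>x_1$ and $(y_1^3-x_1^3)(2t+x_1-y_1)-3x_2^2>0$, and $\Gamma(t,x_1,y_1,x_2)=0$ otherwise.
   Context: For a fixed parameter $y_1\in\mathbb{R}$, the fundamental solution of $\partial_t^2-2\partial_t\partial_{x_1}-x_1^2\partial_{x_2}^2$ is the solution $\Gamma(t,x_1,y_1,x_2)$, in the sense of distributions in the variables $(t,x_1,x_2)$ and with $\Gamma=0$ for $t\le0$, of $$\left(\partial_t^2-2\partial_t\partial_{x_1}-x_1^2\partial_{x_2}^2\right)\Gamma(t,x_1,y_1,x_2)=\delta_{(0,y_1,0)}(t,x_1,x_2),$$ where $\delta_z$ denotes the Dirac delta distribution with mass at $z\in\mathbb{R}^3$. (The parameter $y_1$ is needed because the operator is not translation invariant in $x_1$.) *)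

(* Defs.v *)
From HB Require Import structures.
From mathcomp Require Import all_boot all_order all_algebra.
From mathcomp Require Import all_classical all_reals all_analysis.

Set Implicit Arguments.
Unset Strict Implicit.
Unset Printing Implicit Defensive.

Import Order.TTheory GRing.Theory Num.Theory numFieldNormedType.Exports.
Local Open Scope classical_set_scope.
Local Open Scope ring_scope.

(* A point (t, x1, x2) of R^3 is the nested pair ((t, x1), x2). *)
Notation space3 R := (R * R * R)%type.

Inductive coordinate := Ct | Cx1 | Cx2.

Definition unit_vector (R : realType) (c : coordinate) : space3 R :=
  match c with
  | Ct => (1, 0, 0)
  | Cx1 => (0, 1, 0)
  | Cx2 => (0, 0, 1)
  end.

Definition partial_deriv (R : realType) (c : coordinate) (f : space3 R -> R) :
    space3 R -> R :=
  fun z => 'D_(unit_vector R c) f z.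

(* A list of coordinates plays the role of a multi-index of order [size s]. *)
Definition iter_partial (R : realType) (s : seq coordinate)
    (f : space3 R -> R) : space3 R -> R :=
  foldr (@partial_deriv R) f s.

Definition smooth (R : realType) (f : space3 R -> R) : Prop :=
  forall s : seq coordinate,
    continuous (iter_partial s f) /\
    forall c z, derivable (iter_partial s f) z (unit_vector R c).

Definition supp (R : realType) (f : space3 R -> R) : set (space3 R) :=
  closure [set z | f z != 0].

Definition test_function (R : realType) (f : space3 R -> R) : Prop :=
  smooth f /\ compact (supp f).

(* Functionals are total on [space3 R -> R]; only their values on test
   functions are meaningful. The last clause says that [E] is bounded on the
   test functions supported in [K] by a multiple of a C^N norm. *)
Definition is_distribution (R : realType) (E : (space3 R -> R) -> R) : Prop :=
  (forall (a : R) f g, test_function f -> test_function g ->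
     E (fun z => a * f z + g z) = a * E f + E g) /\
  (forall K : set (space3 R), compact K ->
     exists (C : R) (N : nat), forall f (M : R),
       test_function f -> supp f `<=` K ->
       (forall s z, (size s <= N)%N -> `|iter_partial s f z| <= M) ->
       `|E f| <= C * M).

Definition dist_partial (R : realType) (c : coordinate)
    (E : (space3 R -> R) -> R) : (space3 R -> R) -> R :=
  fun f => - E (partial_deriv c f).

Definition dist_mul (R : realType) (a : space3 R -> R)
    (E : (space3 R -> R) -> R) : (space3 R -> R) -> R :=
  fun f => E (fun z => a z * f z).

Definition dirac_delta (R : realType) (z : space3 R) : (space3 R -> R) -> R :=
  fun f => f z.

Definition lebesgue3 (R : realType) :=
  ((@lebesgue_measure R \x @lebesgue_measure R) \x @lebesgue_measure R)%E.

Definition locally_integrable3 (R : realType) (g : space3 R -> R) : Prop :=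
  @measurable_fun _ _
    (measurableTypeR R * measurableTypeR R * measurableTypeR R)%type
    (measurableTypeR R) setT g /\
  forall K : set (space3 R), compact K ->
    (\int[@lebesgue3 R]_(z in K) `|g z|%:E < +oo)%E.

Definition regular_distribution (R : realType) (g : space3 R -> R) :
    (space3 R -> R) -> R :=
  fun f => \int[@lebesgue3 R]_z (g z * f z).

(* d_t^2 - 2 d_t d_x1 - x1^2 d_x2^2, acting on distributions. *)
Definition wave_op (R : realType) (E : (space3 R -> R) -> R) :
    (space3 R -> R) -> R :=
  fun f => dist_partial Ct (dist_partial Ct E) f
         - 2 * dist_partial Ct (dist_partial Cx1 E) f
         - dist_mul (fun z => z.1.2 ^+ 2)
             (dist_partial Cx2 (dist_partial Cx2 E)) f.

(* The second clause is the vanishing of [E] on the open set t < 0. *)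
Definition fundamental_solution (R : realType) (y1 : R)
    (E : (space3 R -> R) -> R) : Prop :=
  [/\ is_distribution E,
      forall f, test_function f -> supp f `<=` [set z | z.1.1 < 0] ->
        E f = 0 &
      forall f, test_function f ->
        wave_op E f = dirac_delta (0, y1, 0) f].

Definition Gamma (R : realType) (t x1 y1 x2 : R) : R :=
  let D := (y1 ^+ 3 - x1 ^+ 3) * (2 * t + x1 - y1) - 3 * x2 ^+ 2 in
  if [&& 0 < t, x1 < y1 & 0 < D]
  then Num.sqrt 3 / (2 * pi) * (1 / Num.sqrt D)
  else 0.

Definition GammaF (R : realType) (y1 : R) : space3 R -> R :=
  fun z => Gamma z.1.1 z.1.2 y1 z.2.

(* Main.v *)
(* Write p = y1 - x1 and q = 2 t - p. In these coordinates the radicand in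
   Gamma is 3 (z - x2^2), with z = q (y1^3 - (y1 - p)^3) / 3, and the substitution
   x2 = sqrt z sin th turns the pairing of Gamma with a test function F into
   psi F (0, y1, 0), where
     psi F (t, y, x) = 1/(4 pi) * \int_(p > 0) \int_(q > 0)
       \int_(|th| < pi/2) F (t + (p + q)/2, y - p, x + sqrt z sin th).
   Let M_k F (t, y, x, r) be the integral of cos^(2k) th F(t, y, x + r sin th).
   From d_r M_k F = r/(2k+1) M_(k+1) F_xx, which also makes psi F smooth despite
   the square root, and M_0 F = 2 M_1 F + r^2/3 M_2 F_xx, the function
   4 pi psi (P F), P being the wave operator, is the double integral of
     2 d_p (M_0 F_t) - (y - p)^2 d_q (2 q M_1 F_xx),
   hence equals 4 pi F; with y in place of y - p the same computation gives
   P (psi F) = F. The first identity is the fundamental solution property, as P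
   is formally self-adjoint. The second one gives uniqueness: if chi = chi(t)
   vanishes for t <= -1 and equals 1 for t >= -1/2, then g = chi psi F is a test
   function with P g = F for t > -1/2, so any fundamental solution E satisfies
   E F = E (P g) = g (0, y1, 0) = psi F (0, y1, 0). *)

(* The coordinates are characteristic: on functions of (t + (p + q)/2, y - p), d_q acts as d_t/2 and
   d_p as d_t/2 - d_x1, so the principal part d_t^2 - 2 d_t d_x1 is 4 d_p d_q. The function z solves
   d_p z = q (y - p)^2 with z = 0 at p = 0, which is how the coefficient x1^2 enters. The obstacle
   is the square root, singular on the edges p = 0 and q = 0. Derivatives in the parameters t, y, x
   do not meet the singularity, since on these edges z vanishes for every y. Derivatives in p or q
   do, so they are taken only off the corresponding edge, and the integration theorems ask for no
   derivative at end points. The code replaces the quadrant by the square [0, L]^2: if F vanishes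
   after time T and T < t + L/2, nothing is lost, and every integral is that of a continuous
   function over a compact interval. The cutoff is constant on an interval starting at -1/2, not at
   0, because E is only known to vanish on test functions whose closed support lies in t < 0. *)
Require Import Defs.
From HB Require Import structures.
From mathcomp Require Import all_boot all_order all_algebra.
From mathcomp Require Import all_classical all_reals all_analysis.
From mathcomp Require Import measurable_realfun.
From mathcomp Require Import ring lra.
Import Order.TTheory GRing.Theory Num.Theory numFieldNormedType.Exports.
Local Open Scope classical_set_scope.
Local Open Scope ring_scope.
Set Implicit Arguments.
Unset Strict Implicit.
Unset Printing Implicit Defensive.

(** * Integrals depending on a parameter *)

Section one_dim.
Context {R : realType}.
Local Notation mu := (@lebesgue_measure R).
Implicit Types (a b : R).

(* Unlike is_derive, has_deriv is not a class: applying the rules below leaves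
   the derivative hypotheses as subgoals. *)
Definition has_deriv (f : R -> R) (x d : R) : Prop := is_derive x (1 : R) f d.

Lemma continuous_integrable_itv (f : R -> R) a b : continuous f ->
  mu.-integrable `[a, b] (EFin \o f).
Proof.
move=> cf; apply: continuous_compact_integrable; first exact: segment_compact.
exact: continuous_subspaceT.
Qed.

Lemma continuous_pair2 {U V W : topologicalType} (G : U * V -> W) (u : U) :
  continuous G -> continuous (fun s => G (u, s)).
Proof.
move=> cG s; apply: (@continuous_comp _ _ _ (fun s => (u, s)) G); last exact: cG.
by apply: cvg_pair; [exact: cvg_cst|exact: cvg_id].
Qed.

(** Compactness of [[a, b]] makes the continuity of [G] in [u] uniform in [s]. This argument works
    over any topological space [U], where dominated convergence along sequences would not
    suffice. *)
Lemma continuous_Rintegral {U : topologicalType} (G : U * R -> R) a b :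
  continuous G -> continuous (fun u => \int[mu]_(s in `[a, b]) G (u, s)).
Proof.
move=> cG u0; have [ab|ba] := leP a b; last first.
  by rewrite set_itv_ge ?bnd_simp -?ltNge//; under eq_fun do rewrite Rintegral_set0;
  exact: cvg_cst.
apply/cvgrPdist_le => /= e e0.
(* The [+ 1] keeps the denominator positive when a = b. *)
pose d := e / (b - a + 1).
have d0 : 0 < d by rewrite divr_gt0// ltr_pwDr// subr_ge0.
have : \forall u \near u0, `[a, b] `<=` (fun s => `|G (u0, s) - G (u, s)| <= d).
  have /compact_near_coveringP := @segment_compact R a b.
  apply => s sab.
  have /cvgrPdist_le/(_ (d / 2)) := cG (u0, s).
  have d20 : 0 < d / 2 by rewrite divr_gt0.
  move=> /(_ d20) [[A B] /= [A0 B0] AB].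
  exists (B, A) => //= -[s' u] /= [Bs' Au].
  have := AB (u, s') (conj Au Bs').
  have := AB (u0, s') (conj (nbhs_singleton A0) Bs').
  move=> /= h1 h2.
  rewrite (_ : _ - _ = (G (u0, s) - G (u, s')) - (G (u0, s) - G (u0, s'))); last by ring.
  by rewrite (le_trans (ler_normB _ _))// (splitr d) lerD.
apply: filterS => u hu.
have i0 := @continuous_integrable_itv _ a b (@continuous_pair2 _ _ _ G u0 cG).
have iu := @continuous_integrable_itv _ a b (@continuous_pair2 _ _ _ G u cG).
rewrite -RintegralB//.
have cd : continuous (fun s => G (u0, s) - G (u, s)).
  by move=> s; apply: cvgB; exact: continuous_pair2.
apply: (le_trans (le_normr_Rintegral _ _)) => //.
  exact: continuous_integrable_itv.
apply: (@le_trans _ _ (\int[mu]_(s in `[a, b]) d)).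
  apply: le_Rintegral => //.
  - apply: (@continuous_integrable_itv (fun s => `|G (u0, s) - G (u, s)|)) => s.
    by apply: (continuous_comp (cd s)); exact: norm_continuous.
  - by apply: (@continuous_integrable_itv (fun=> d)) => s; exact: cvg_cst.
rewrite Rintegral_cst//= lebesgue_measure_itv/= lte_fin.
case: ifPn => [_|_] /=; last by rewrite mulr0 ltW.
by rewrite /d mulrAC ler_pdivrMr ?ler_pM2l ?lerDl// ltr_pwDr// subr_ge0.
Qed.

(** Joint continuity of [G'] bounds it on a compact rectangle, and that constant dominates. The
    derivative is required only near [u0] because the kernel will be differentiable in p only for p
    > 0. *)
Lemma has_deriv_Rintegral (G G' : R -> R -> R) a b u0 :
  continuous (fun w : R * R => G w.1 w.2) ->
  continuous (fun w : R * R => G' w.1 w.2) ->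
  (\forall u \near u0, forall s, s \in `[a, b] -> has_deriv (G ^~ s) u (G' u s)) ->
  has_deriv (fun u => \int[mu]_(s in `[a, b]) G u s) u0
    (\int[mu]_(s in `[a, b]) G' u0 s).
Proof.
move=> cG cG' [e /= e0 dG].
have I0 : `]u0 - e, u0 + e[%classic u0.
  by rewrite /= in_itv/= ltrBlDr !ltrDl e0.
have Ie u : `]u0 - e, u0 + e[%classic u -> `|u0 - u| < e.
  by rewrite /= in_itv/= ltr_norml => /andP[h1 h2]; apply/andP; split; lra.
have D1 u s : `]u0 - e, u0 + e[%classic u -> s \in `[a, b] -> partial1of2 G u s = G' u s.
  move=> /Ie ue sab; rewrite partial1of2E; apply: derive_val.
  exact: (dG u ue s sab).
have [M HM] : exists M : R, forall u s, u \in `[u0 - e, u0 + e] -> s \in `[a, b] ->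
    `|G' u s| <= M.
  have : compact ((fun w : R * R => G' w.1 w.2) @`
      (`[u0 - e, u0 + e] `*` `[a, b])).
    apply: continuous_compact; first exact: continuous_subspaceT.
    by apply: compact_setX; exact: segment_compact.
  move=> /compact_bounded [M [_ HM]]; exists (M + 1) => u s ui si.
  by apply: (HM (M + 1)); [rewrite ltrDl|exists (u, s)].
have cGu u : continuous (G u).
  exact: (@continuous_pair2 _ _ _ (fun w : R * R => G w.1 w.2) u).
have iG x : `]u0 - e, u0 + e[%classic x -> mu.-integrable `[a, b] (EFin \o G x).
  by move=> _; exact: continuous_integrable_itv.
have dG1 x y : `]u0 - e, u0 + e[%classic x -> `[a, b]%classic y ->
    derivable (G ^~ y) x 1.
  by move=> /Ie xe yab; have := dG x xe y yab; apply: @ex_derive.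
have M0 : 0 <= `|M| by [].
have iM : mu.-integrable `[a, b] (EFin \o (fun=> `|M|) : R -> \bar R).
  by apply: continuous_integrable_itv => s; exact: cvg_cst.
have ub x y : `]u0 - e, u0 + e[%classic x -> `[a, b]%classic y ->
    `|partial1of2 G x y| <= `|M|.
  move=> xI yab; rewrite D1//; apply: le_trans (ler_norm M).
  by apply: HM => //; apply: subset_itv_oo_cc.
have mab : measurable (`[a, b] : set (measurableTypeR R)) by [].
have := @differentiation_under_integral R _ _ mu G `[a, b] mab _ _ _ I0 iG dG1 _ (fun=> M0) iM ub.
have := @derivable_under_integral R _ _ mu G `[a, b] mab _ _ _ I0 iG dG1 _ (fun=> M0) iM ub.
rewrite derive1E => h1 h2; apply: DeriveDef => //; rewrite h2.
by apply: eq_Rintegral => s; rewrite inE => si; exact: D1.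
Qed.

(** The derivative is asked for only in the open interval: the antiderivatives used later contain a
    square root that may be singular at an end point. *)
Lemma Rintegral_FTC (F f : R -> R) a b : a <= b -> continuous f -> continuous F ->
  (forall s, s \in `]a, b[ -> has_deriv F s (f s)) ->
  \int[mu]_(s in `[a, b]) f s = F b - F a.
Proof.
rewrite le_eqVlt => /predU1P[<- _ _ _|ab cf cF dF].
  by rewrite set_itv1 Rintegral_set1 subrr.
rewrite /Rintegral (@continuous_FTC2 _ f F)//.
- exact: continuous_subspaceT.
- split=> [s sab||].
  + by have := dF s sab; apply: @ex_derive.
  + by apply: cvg_at_right_filter; exact: cF.
  + by apply: cvg_at_left_filter; exact: cF.
- by move=> s sab; rewrite derive1E; apply: derive_val; exact: dF.
Qed.

(* Moving only the first argument costs H'(xi, s) (alpha s - alpha s0) by the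
   mean value theorem, so no derivative of H in its second argument is needed
   away from s0. *)
Lemma has_deriv_chain (H H' : R -> R -> R) (alpha : R -> R) (s0 da d : R) :
  (forall u s, has_deriv (H ^~ s) u (H' u s)) ->
  {for (alpha s0, s0), continuous (fun w : R * R => H' w.1 w.2)} ->
  has_deriv alpha s0 da -> has_deriv (H (alpha s0)) s0 d ->
  has_deriv (fun s => H (alpha s) s) s0 (H' (alpha s0) s0 * da + d).
Proof.
move=> dH cH' dalpha dH2.
have mvt u v s : exists2 xi, `|xi - u| <= `|v - u| & H v s - H u s = H' xi s * (v - u).
  have cH w x : {within `[w, x], continuous (H ^~ s)}.
    by apply: derivable_within_continuous => y _; have := dH y s; apply: @ex_derive.
  have [uv|vu] := leP u v.
    have [xi] := @MVT_segment _ (H ^~ s) (H' ^~ s) u v uv (fun y _ => dH y s) (cH _ _).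
    rewrite in_itv/= => /andP[h1 h2] E; exists xi => //.
    by rewrite !ger0_norm ?subr_ge0// lerD2r.
  have [xi] := @MVT_segment _ (H ^~ s) (H' ^~ s) v u (ltW vu) (fun y _ => dH y s) (cH _ _).
  rewrite in_itv/= => /andP[h1 h2] E; exists xi => //.
    by rewrite !ler0_norm ?subr_le0 ?(ltW vu)// lerN2 lerD2r.
  by rewrite -[LHS]opprB E -mulrN opprB.
have ca : {for s0, continuous alpha}.
  by apply: differentiable_continuous; apply/derivable1_diffP; apply: @ex_derive dalpha.
have key : (fun h => h^-1 * (H (alpha (h + s0)) (h + s0) - H (alpha s0) (h + s0)))
    @ 0^' --> H' (alpha s0) s0 * da.
  (* The intermediate points are chosen as one function of the increment, so that a limit can be
     taken: they are squeezed towards [alpha s0]. *)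
  have /choice[xi hxi] : forall h, exists xi, `|xi - alpha s0| <= `|alpha (h + s0) - alpha s0|
     /\ H (alpha (h + s0)) (h + s0) - H (alpha s0) (h + s0) =
        H' xi (h + s0) * (alpha (h + s0) - alpha s0).
    by move=> h; have [xi] := mvt (alpha s0) (alpha (h + s0)) (h + s0); exists xi.
  under eq_fun do rewrite (hxi _).2 mulrCA.
  have shift0 : (fun h : R => h + s0) @ 0^' --> s0.
    apply: cvg_within_filter; rewrite -{2}[s0]add0r.
    by apply: cvgD; [exact: cvg_id|exact: cvg_cst].
  apply: cvgM.
    apply: (@cvg_comp _ _ _ (fun h => (xi h, h + s0)) (fun w : R * R => H' w.1 w.2)); last exact: cH'.
    have cxi : xi @ 0^' --> alpha s0.
      apply/cvgrPdist_le => e e0.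
      have /cvgrPdist_le/(_ e e0) := cvg_comp _ _ shift0 ca.
      apply: filterS => h /= hh.
      by rewrite distrC (le_trans (hxi h).1)// distrC; exact: hh.
    exact: (@cvg_pair _ _ _ _ (nbhs (alpha s0)) (nbhs s0) _ _ _ xi _ cxi shift0).
  have [/cvg_ex[l hl] E] := dalpha.
  have El : l = da by rewrite -E /derive; apply/esym/cvg_lim.
  rewrite El in hl.
  by move: hl; under eq_fun do rewrite /= scaler1.
have hd : (fun h => h^-1 * (H (alpha s0) (h + s0) - H (alpha s0) s0)) @ 0^' --> d.
  have [/cvg_ex[l hl] E] := dH2.
  have El : l = d by rewrite -E /derive; apply/esym/cvg_lim.
  by rewrite El in hl; move: hl; under eq_fun do rewrite /= scaler1.
have hs : (fun h => h^-1 *: (((fun s => H (alpha s) s) \o shift s0) (h *: (1 : R)) -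
    H (alpha s0) s0)) @ 0^' --> H' (alpha s0) s0 * da + d.
  under eq_fun do rewrite /= scaler1.
  apply: cvg_trans (cvgD key hd); apply: near_eq_cvg; apply: nearW => h /=.
  by rewrite fctE -mulrDr addrA subrK.
by apply: DeriveDef; [apply/cvg_ex; eexists; exact: hs|apply/cvg_lim].
Qed.

End one_dim.

(** * Rules for continuity, one-variable derivatives and linearity of integrals *)

Section pointwise_rules.
Context {R : realType}.
Local Notation mu := (@lebesgue_measure R).

Section continuity.
Context {U : topologicalType}.
Implicit Types f g : U -> R.

Lemma cont_cst (V : topologicalType) (c : V) : continuous (fun _ : U => c).
Proof. by move=> u; exact: cvg_cst. Qed.

Lemma cont_id : continuous (fun u : U => u).
Proof. by move=> u; exact: cvg_id. Qed.

Lemma cont_comp (V W : topologicalType) (h : V -> W) (k : U -> V) :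
  continuous h -> continuous k -> continuous (fun u => h (k u)).
Proof. by move=> ch ck u; apply: continuous_comp; [exact: ck|exact: ch]. Qed.

Lemma cont_fst (V W : topologicalType) (k : U -> V * W) :
  continuous k -> continuous (fun u => (k u).1).
Proof. by apply: cont_comp => u; exact: cvg_fst. Qed.

Lemma cont_snd (V W : topologicalType) (k : U -> V * W) :
  continuous k -> continuous (fun u => (k u).2).
Proof. by apply: cont_comp => u; exact: cvg_snd. Qed.

Lemma cont_pair (V W : topologicalType) (h : U -> V) (k : U -> W) :
  continuous h -> continuous k -> continuous (fun u => (h u, k u)).
Proof. by move=> ch ck u; apply: cvg_pair; [exact: ch|exact: ck]. Qed.

Lemma contD f g : continuous f -> continuous g -> continuous (fun u => f u + g u).
Proof. by move=> cf cg u; apply: cvgD; [exact: cf|exact: cg]. Qed.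

Lemma contN f : continuous f -> continuous (fun u => - f u).
Proof. by move=> cf u; apply: cvgN; exact: cf. Qed.

Lemma contM f g : continuous f -> continuous g -> continuous (fun u => f u * g u).
Proof. by move=> cf cg u; apply: cvgM; [exact: cf|exact: cg]. Qed.

Lemma contX f n : continuous f -> continuous (fun u => f u ^+ n).
Proof.
move=> cf; elim: n => [|n IH]; first by under eq_fun do rewrite expr0; exact: cont_cst.
by under eq_fun do rewrite exprS; exact: contM.
Qed.

Lemma cont_sqrt f : continuous f -> continuous (fun u => Num.sqrt (f u)).
Proof. by apply: cont_comp; exact: sqrt_continuous. Qed.

Lemma cont_sin f : continuous f -> continuous (fun u => sin (f u)).
Proof. by apply: cont_comp; exact: continuous_sin. Qed.

Lemma cont_cos f : continuous f -> continuous (fun u => cos (f u)).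
Proof. by apply: cont_comp; exact: continuous_cos. Qed.

End continuity.

Section derivation.
Implicit Types (f g : R -> R) (x : R).

Lemma has_deriv_eq f x d d' : has_deriv f x d -> d = d' -> has_deriv f x d'.
Proof. by move=> ? <-. Qed.

Lemma has_deriv_cst (c : R) x : has_deriv (fun=> c) x 0.
Proof. exact: is_derive_cst. Qed.

Lemma has_deriv_id x : has_deriv (fun s => s) x 1.
Proof. exact: is_derive_id. Qed.

Lemma has_derivD f g x df dg : has_deriv f x df -> has_deriv g x dg ->
  has_deriv (fun s => f s + g s) x (df + dg).
Proof. by move=> hf hg; exact: is_deriveD. Qed.

Lemma has_derivN f x df : has_deriv f x df -> has_deriv (fun s => - f s) x (- df).
Proof. by move=> hf; exact: is_deriveN. Qed.

Lemma has_derivM f g x df dg : has_deriv f x df -> has_deriv g x dg ->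
  has_deriv (fun s => f s * g s) x (df * g x + f x * dg).
Proof.
move=> hf hg; apply: (@has_deriv_eq _ _ (f x *: dg + g x *: df)).
  exact: (is_deriveM hf hg).
by rewrite /GRing.scale/= addrC [g x * _]mulrC.
Qed.

Lemma has_derivZ f x (c df : R) : has_deriv f x df -> has_deriv (fun s => c * f s) x (c * df).
Proof. by move=> hf; have := has_derivM (has_deriv_cst c x) hf; rewrite mul0r add0r. Qed.

Lemma has_derivX f x n df : has_deriv f x df ->
  has_deriv (fun s => f s ^+ n) x (n%:R * f x ^+ n.-1 * df).
Proof.
move=> hf; rewrite (_ : (fun s => f s ^+ n) = f ^+ n); first exact: (is_deriveX n hf).
by apply/funext => s; rewrite fctE.
Qed.

Lemma has_deriv_comp f g x df dg : has_deriv f (g x) df -> has_deriv g x dg ->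
  has_deriv (fun s => f (g s)) x (df * dg).
Proof. by move=> hf hg; exact: (is_derive1_comp hf hg). Qed.

Lemma has_deriv_sin x : has_deriv sin x (cos x).
Proof. exact: is_derive_sin. Qed.

Lemma has_deriv_cos x : has_deriv cos x (- sin x).
Proof. exact: is_derive_cos. Qed.

End derivation.

Lemma RintD (f g : R -> R) a b : continuous f -> continuous g ->
  \int[mu]_(s in `[a, b]) (f s + g s) =
  \int[mu]_(s in `[a, b]) f s + \int[mu]_(s in `[a, b]) g s.
Proof. by move=> cf cg; rewrite RintegralD//; exact: continuous_integrable_itv. Qed.

Lemma RintZ (f : R -> R) (c : R) a b : continuous f ->
  \int[mu]_(s in `[a, b]) (c * f s) = c * \int[mu]_(s in `[a, b]) f s.
Proof. by move=> cf; rewrite RintegralZl//; exact: continuous_integrable_itv. Qed.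

End pointwise_rules.

(** The partially applied heads such as [+%R _] or [pair _] are eta-contracted forms of the same
    rules. Hypotheses are matched by [constr_eq], so no function is unfolded to make one fit. *)
Ltac cont1 :=
  lazymatch goal with
  | |- continuous (fun _ => ?c) => apply: cont_cst
  | |- continuous (fun u => u) => apply: cont_id
  | |- continuous fst => exact: (cont_fst (@cont_id _))
  | |- continuous snd => exact: (cont_snd (@cont_id _))
  | |- continuous ( *%R _) => apply: contM; [exact: cont_cst|exact: cont_id]
  | |- continuous (+%R _) => apply: contD; [exact: cont_cst|exact: cont_id]
  | |- continuous -%R => exact: (contN (@cont_id _))
  | |- continuous (pair _) => apply: cont_pair; [exact: cont_cst|exact: cont_id]
  | |- continuous sin => exact: continuous_sin
  | |- continuous cos => exact: continuous_cos
  | |- continuous (fun u => fst _) => apply: cont_fst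
  | |- continuous (fun u => snd _) => apply: cont_snd
  | |- continuous (fun u => pair _ _) => apply: cont_pair
  | |- continuous (fun u => _ + _) => apply: contD
  | |- continuous (fun u => - _) => apply: contN
  | |- continuous (fun u => _ * _) => apply: contM
  | |- continuous (fun u => _ ^+ _) => apply: contX
  | |- continuous (fun u => Num.sqrt _) => apply: cont_sqrt
  | |- continuous (fun u => sin _) => apply: cont_sin
  | |- continuous (fun u => cos _) => apply: cont_cos
  | |- continuous (fun u => ?F _) =>
      match goal with H : continuous ?F' |- _ =>
        constr_eq F F'; first [exact: H | apply: (cont_comp H)] end
  | |- continuous ?F =>
      match goal with H : continuous ?F' |- _ => constr_eq F F'; exact: H end
  end.
Ltac cont := move=> /=; repeat cont1.

Lemma near_all (R : realType) (u0 : R) (P : R -> Prop) :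
  (forall u, P u) -> \forall u \near u0, P u.
Proof. by move=> h; exists 1 => //= u _; exact: h. Qed.

(* The locked copies pd and circ keep unification from unfolding and comparing
   distinct derivatives. *)
HB.lock Definition pd (R : realType) (c : coordinate) (F : space3 R -> R) : space3 R -> R :=
  partial_deriv c F.

Lemma pdE (R : realType) (c : coordinate) (F : space3 R -> R) : pd c F = partial_deriv c F.
Proof. by rewrite pd.unlock. Qed.

Lemma has_deriv_near (R : realType) (f g : R -> R) (x d : R) :
  (\forall s \near x, f s = g s) -> has_deriv f x d -> has_deriv g x d.
Proof. exact: near_eq_is_derive. Qed.

(** * Partial derivatives as one-variable derivatives along coordinate lines *)

Section smooth_theory.
Context {R : realType}.
Implicit Types (F : space3 R -> R) (c : coordinate).

Lemma smooth_pd F c : smooth F -> smooth (pd c F).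
Proof.
by rewrite pdE => sF s; have := sF (rcons s c); rewrite /iter_partial foldr_rcons.
Qed.

Lemma smooth_continuous F : smooth F -> continuous F.
Proof. by move=> /(_ [::]) []. Qed.

Lemma is_derive_line (V : normedModType R) (f : V -> R) (g : R -> R) (z v : V) (u d : R) :
  (forall h : R, g (h + u) = f (h *: v + z)) ->
  is_derive z v f d <-> has_deriv g u d.
Proof.
move=> E.
have Eu : g u = f z by rewrite -(add0r u) E scale0r add0r.
have EE : (fun h : R => h^-1 *: ((f \o shift z) (h *: v) - f z)) =
          (fun h : R => h^-1 *: ((g \o shift u) (h *: (1 : R)) - g u)).
  by apply/funext => h /=; rewrite scaler1 E Eu.
by rewrite /has_deriv; split => -[h1 h2]; apply: DeriveDef; move: h1 h2; rewrite /derivable /derive EE.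
Qed.

Definition line c (z : space3 R) (s : R) : space3 R :=
  match c with Ct => (s, z.1.2, z.2) | Cx1 => (z.1.1, s, z.2) | Cx2 => (z.1, s) end.

Definition coord_of c (z : space3 R) : R :=
  match c with Ct => z.1.1 | Cx1 => z.1.2 | Cx2 => z.2 end.

Lemma is_derive_coord F c z d :
  is_derive z (unit_vector R c) F d <->
  has_deriv (fun s => F (line c z s)) (coord_of c z) d.
Proof.
apply: is_derive_line => h; congr F; case: c; case: z => [[t y] x] /=.
all: by congr (_, _, _); rewrite /= /GRing.scale/= ?mulr1 ?mulr0 ?add0r.
Qed.

Lemma smooth_is_derive F c z : smooth F ->
  has_deriv (fun s => F (line c z s)) (coord_of c z) (pd c F z).
Proof.
rewrite pdE => sF; apply/is_derive_coord; apply: DeriveDef; last by [].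
by have [_] := sF [::]; apply.
Qed.

Lemma smooth_dert F t y x : smooth F ->
  has_deriv (fun s => F (s, y, x)) t
    (pd Ct F (t, y, x)).
Proof. exact: (@smooth_is_derive F Ct (t, y, x)). Qed.

Lemma smooth_der1 F t y x : smooth F ->
  has_deriv (fun s => F (t, s, x)) y
    (pd Cx1 F (t, y, x)).
Proof. exact: (@smooth_is_derive F Cx1 (t, y, x)). Qed.

Lemma smooth_der2 F t y x : smooth F ->
  has_deriv (fun s => F (t, y, s)) x
    (pd Cx2 F (t, y, x)).
Proof. exact: (@smooth_is_derive F Cx2 (t, y, x)). Qed.

Lemma pd_eq F c z d :
  has_deriv (fun s => F (line c z s)) (coord_of c z) d -> pd c F z = d.
Proof. by rewrite pdE => /is_derive_coord h; apply: derive_val. Qed.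

End smooth_theory.

(** This is [M_k] of the overview; the exponent [k.*2] is 2k. *)
HB.lock Definition circ (R : realType) (k : nat) (F : space3 R -> R) (t y x r : R) : R :=
  \int[@lebesgue_measure R]_(th in `[- (pi / 2), pi / 2])
    (cos th ^+ k.*2 * F (t, y, x + r * sin th)).

Lemma circE (R : realType) k (F : space3 R -> R) t y x r : circ k F t y x r =
  \int[@lebesgue_measure R]_(th in `[- (pi / 2), pi / 2])
    (cos th ^+ k.*2 * F (t, y, x + r * sin th)).
Proof. by rewrite circ.unlock. Qed.

(** * The means [M_k] and their derivatives *)

Section circle_means.
Context {R : realType}.
Local Notation mu := (@lebesgue_measure R).
Implicit Types (F : space3 R -> R).

Lemma cont_circ (U : topologicalType) k F (t y x r : U -> R) : continuous F ->
  continuous t -> continuous y -> continuous x -> continuous r ->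
  continuous (fun u => circ k F (t u) (y u) (x u) (r u)).
Proof.
move=> cF ct cy cx cr.
under eq_fun do rewrite circE.
apply: (@continuous_Rintegral _ _ (fun w : U * R => cos w.2 ^+ k.*2 *
  F (t w.1, y w.1, x w.1 + r w.1 * sin w.2))).
by cont.
Qed.

Lemma pihalf_le : - (pi / 2) <= pi / 2 :> R.
Proof. by rewrite -subr_ge0 opprK addr_ge0// divr_ge0// pi_ge0. Qed.

Lemma circ_dert k F t y x r : smooth F ->
  has_deriv (fun s => circ k F s y x r) t
    (circ k (pd Ct F) t y x r).
Proof.
move=> sF; have cF := smooth_continuous sF.
have cF' := smooth_continuous (smooth_pd Ct sF).
rewrite ?circE; under eq_fun do rewrite circE.
apply: (@has_deriv_Rintegral _ (fun s th => cos th ^+ k.*2 * F (s, y, x + r * sin th))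
  (fun s th => cos th ^+ k.*2 * pd Ct F (s, y, x + r * sin th))).
- by cont.
- by cont.
- by apply: near_all => u s _; apply: has_derivZ; exact: smooth_dert.
Qed.

Lemma circ_der1 k F t y x r : smooth F ->
  has_deriv (fun s => circ k F t s x r) y
    (circ k (pd Cx1 F) t y x r).
Proof.
move=> sF; have cF := smooth_continuous sF.
have cF' := smooth_continuous (smooth_pd Cx1 sF).
rewrite ?circE; under eq_fun do rewrite circE.
apply: (@has_deriv_Rintegral _ (fun s th => cos th ^+ k.*2 * F (t, s, x + r * sin th))
  (fun s th => cos th ^+ k.*2 * pd Cx1 F (t, s, x + r * sin th))).
- by cont.
- by cont.
- by apply: near_all => u s _; apply: has_derivZ; exact: smooth_der1.
Qed.

Lemma circ_der2 k F t y x r : smooth F ->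
  has_deriv (fun s => circ k F t y s r) x
    (circ k (pd Cx2 F) t y x r).
Proof.
move=> sF; have cF := smooth_continuous sF.
have cF' := smooth_continuous (smooth_pd Cx2 sF).
rewrite ?circE; under eq_fun do rewrite circE.
apply: (@has_deriv_Rintegral _ (fun s th => cos th ^+ k.*2 * F (t, y, s + r * sin th))
  (fun s th => cos th ^+ k.*2 * pd Cx2 F (t, y, s + r * sin th))).
- by cont.
- by cont.
- apply: near_all => u s _; apply: has_derivZ; apply: has_deriv_eq.
    apply: (@has_deriv_comp R (fun v => F (t, y, v)) (fun u => u + r * sin s)).
      exact: smooth_der2.
    apply: has_derivD; [exact: has_deriv_id|exact: has_deriv_cst].
  by rewrite addr0 mulr1.
Qed.

Lemma der_line2 F t y x r th : smooth F ->
  has_deriv (fun th => F (t, y, x + r * sin th)) th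
    (pd Cx2 F (t, y, x + r * sin th) * (r * cos th)).
Proof.
move=> sF; apply: (@has_deriv_comp R (fun v => F (t, y, v)) (fun th => x + r * sin th)).
  exact: smooth_der2.
apply: has_deriv_eq; first by apply: (has_derivD (has_deriv_cst _ _)); apply: has_derivZ; exact: has_deriv_sin.
by rewrite add0r.
Qed.

(** Differentiation in the radius produces a factor sin th, which is integrated by parts: cos^(2k+1)
    th F_x vanishes at both ends, and its th-derivative is -(2k+1) cos^(2k) th sin th F_x + r
    cos^(2k+2) th F_xx. The factor [r] gained here later cancels the singularity of the square
    root. *)
Lemma circ_derr k F t y x r : smooth F ->
  has_deriv (fun s => circ k F t y x s) r
    (r / (k.*2.+1)%:R * circ k.+1 (pd Cx2 (pd Cx2 F)) t y x r).
Proof.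
move=> sF; have cF := smooth_continuous sF.
have sF' := smooth_pd Cx2 sF; have cF' := smooth_continuous sF'.
have sF'' := smooth_pd Cx2 sF'; have cF'' := smooth_continuous sF''.
apply: has_deriv_eq.
  under eq_fun do rewrite circE.
  apply: (@has_deriv_Rintegral _ (fun s th => cos th ^+ k.*2 * F (t, y, x + s * sin th))
   (fun s th => cos th ^+ k.*2 * (pd Cx2 F (t, y, x + s * sin th) * sin th))).
  - by cont.
  - by cont.
  - apply: near_all => u s _; apply: has_derivZ.
    apply: (@has_deriv_comp R (fun v => F (t, y, v)) (fun u => x + u * sin s)).
      exact: smooth_der2.
    apply: has_deriv_eq.
      by apply: has_derivD; [exact: has_deriv_cst|apply: has_derivM; [exact: has_deriv_id|exact: has_deriv_cst]].
    by rewrite mulr0 addr0 add0r mul1r.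
pose Phi th := cos th ^+ k.*2.+1 * pd Cx2 F (t, y, x + r * sin th).
have P0 : Phi (pi / 2) - Phi (- (pi / 2)) = 0.
  by rewrite /Phi cosN cos_pihalf expr0n/= !mul0r subrr.
rewrite -(@Rintegral_FTC _ Phi (fun th => (- (k.*2.+1)%:R) *
    (cos th ^+ k.*2 * (pd Cx2 F (t, y, x + r * sin th) * sin th)) +
    r * (cos th ^+ k.+1.*2 *
    pd Cx2 (pd Cx2 F) (t, y, x + r * sin th)))) in P0 => //.
- move: P0; rewrite RintD ?RintZ; [|by cont..].
  rewrite -circE mulNr => /eqP; rewrite addrC subr_eq0 => /eqP E.
  have n0 : (k.*2.+1)%:R != 0 :> R by rewrite pnatr_eq0.
  by rewrite -[LHS](mulKf n0) -E mulrCA mulrA.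
- exact: pihalf_le.
- by cont.
- by rewrite /Phi; cont.
- move=> s _; apply: has_deriv_eq.
    by apply: has_derivM; [apply: has_derivX; exact: has_deriv_cos|exact: der_line2].
  by rewrite /= doubleS !exprS; ring.
Qed.

(* Integrates the theta-derivative of sin cos F + (r/3) cos^3 F_x along the circle. *)
Lemma circ_recurrence F t y x r : smooth F ->
  circ 0 F t y x r = 2 * circ 1 F t y x r +
    r ^+ 2 / 3 * circ 2 (pd Cx2 (pd Cx2 F)) t y x r.
Proof.
move=> sF; have cF := smooth_continuous sF.
have sF' := smooth_pd Cx2 sF; have cF' := smooth_continuous sF'.
have sF'' := smooth_pd Cx2 sF'; have cF'' := smooth_continuous sF''.
pose Phi th := sin th * cos th * F (t, y, x + r * sin th) +
  r / 3 * (cos th ^+ 3 * pd Cx2 F (t, y, x + r * sin th)).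
have P0 : Phi (pi / 2) - Phi (- (pi / 2)) = 0.
  by rewrite /Phi cosN cos_pihalf expr0n/= !(mulr0,mul0r) subrr.
rewrite -(@Rintegral_FTC _ Phi (fun th =>
    (2 * (cos th ^+ 1.*2 * F (t, y, x + r * sin th)) +
    r ^+ 2 / 3 * (cos th ^+ 2.*2 *
    pd Cx2 (pd Cx2 F) (t, y, x + r * sin th))) +
    (-1) * (cos th ^+ 0.*2 * F (t, y, x + r * sin th)))) in P0 => //.
- move: P0; rewrite !(RintD, RintZ); [|by cont..]; rewrite -!circE.
  have -> : circ 0 F t y x r = \int[mu]_(s in `[- (pi / 2), pi / 2]) F (t, y, x + r * sin s).
    by rewrite circE; apply: eq_Rintegral => s _; rewrite expr0 mul1r.
  by rewrite mulN1r mul1r => /eqP; rewrite subr_eq0 => /eqP ->.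
- exact: pihalf_le.
- by cont.
- by rewrite /Phi; cont.
- move=> s _; apply: has_deriv_eq.
    apply: has_derivD; [apply: has_derivM|apply: has_derivZ; apply: has_derivM].
    + by apply: has_derivM; [exact: has_deriv_sin|exact: has_deriv_cos].
    + exact: der_line2.
    + by apply: has_derivX; exact: has_deriv_cos.
    + exact: der_line2.
  have := sin2cos2 s => E; rewrite /= expr0.
  set A := F _; set B := pd _ F _; set C := pd _ _ _.
  have -> : sin s * - sin s = cos s ^+ 2 - 1 by rewrite mulrN -expr2 E opprB.
  by field.
Qed.

Lemma circ0 F t y x : circ 0 F t y x 0 = pi * F (t, y, x).
Proof.
rewrite circE; under eq_Rintegral do rewrite mul0r addr0 expr0 mul1r.
rewrite Rintegral_cst//= lebesgue_measure_itv/= lte_fin ifT.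
  by rewrite -EFinB/= opprK -splitr mulrC.
by rewrite -subr_gt0 opprK -splitr pi_gt0.
Qed.

End circle_means.

(** * Mixed derivatives and double integrals *)

Section more_derivatives.
Context {R : realType}.
Local Notation mu := (@lebesgue_measure R).

Lemma has_deriv_unique (f : R -> R) x d d' : has_deriv f x d -> has_deriv f x d' -> d = d'.
Proof. by move=> [_ <-] [_ <-]. Qed.

(** F(s, y, v) is F(s, y, x - 1) plus the integral of F_x from x - 1 to v. Differentiating this
    under the integral sign in s and then in v gives both mixed derivatives. The base point x - 1
    makes x an interior point. *)
Lemma schwarz (F : space3 R -> R) : smooth F ->
  pd Cx2 (pd Ct F) = pd Ct (pd Cx2 F).
Proof.
move=> sF; apply/funext => -[[t y] x].
have sFt := smooth_pd Ct sF.
have sFx := smooth_pd Cx2 sF.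
have sFxt := smooth_pd Ct sFx.
have cFx := smooth_continuous sFx; have cFxt := smooth_continuous sFxt.
have cF := smooth_continuous sF; have cFt := smooth_continuous sFt.
apply: (@pd_eq _ _ Cx2) => /=.
have FTC s v : x - 1 <= v -> F (s, y, v) = F (s, y, x - 1) +
    \int[mu]_(u in `[x - 1, v]) pd Cx2 F (s, y, u).
  move=> xv; rewrite (@Rintegral_FTC _ (fun u => F (s, y, u)))//.
  - by rewrite addrC subrK.
  - by cont.
  - by cont.
  - by move=> u _; exact: smooth_der2.
have E v : x - 1 <= v -> pd Ct F (t, y, v) = pd Ct F (t, y, x - 1) +
    \int[mu]_(u in `[x - 1, v]) pd Ct (pd Cx2 F) (t, y, u).
  move=> xv; apply: (@has_deriv_unique (fun s => F (s, y, v)) t); first exact: smooth_dert.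
  under eq_fun do rewrite FTC//.
  apply: has_derivD; first exact: smooth_dert.
  apply: (@has_deriv_Rintegral _ (fun s u => pd Cx2 F (s, y, u))
    (fun s u => pd Ct (pd Cx2 F) (s, y, u))).
  - by cont.
  - by cont.
  - by apply: near_all => u s _; exact: smooth_dert.
have cg : continuous (fun u => pd Ct (pd Cx2 F) (t, y, u)) by cont.
have x1 : x < x + 1 by rewrite ltrDl.
have x1' : x - 1 < x by rewrite ltrBlDr ltrDl.
have [h1 h2] := @continuous_FTC1_closed R _ (x - 1) x (x + 1) x1
   (continuous_integrable_itv _ _ cg) x1' (cg x).
have h3 := has_derivD (has_deriv_cst (pd Ct F (t, y, x - 1)) x)
   (DeriveDef h1 (etrans (esym (derive1E _ _)) h2)).
rewrite add0r in h3; apply: near_eq_is_derive h3.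
exists 1 => //= v /=; rewrite ltr_norml => /andP[_ hv].
by apply/esym/E; lra.
Qed.

Lemma has_deriv_Rintegral2 (G G' : R -> R -> R -> R) a b u0 :
  continuous (fun w : R * R * R => G w.1.1 w.1.2 w.2) ->
  continuous (fun w : R * R * R => G' w.1.1 w.1.2 w.2) ->
  (forall u p q, p \in `[a, b] -> q \in `[a, b] -> has_deriv (fun u => G u p q) u (G' u p q)) ->
  has_deriv (fun u => \int[mu]_(p in `[a, b]) \int[mu]_(q in `[a, b]) G u p q) u0
    (\int[mu]_(p in `[a, b]) \int[mu]_(q in `[a, b]) G' u0 p q).
Proof.
move=> cG cG' dG.
apply: (@has_deriv_Rintegral _ (fun u p => \int[mu]_(q in `[a, b]) G u p q)
  (fun u p => \int[mu]_(q in `[a, b]) G' u p q)).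
- exact: (@continuous_Rintegral _ (R * R)%type (fun w => G w.1.1 w.1.2 w.2)).
- exact: (@continuous_Rintegral _ (R * R)%type (fun w => G' w.1.1 w.1.2 w.2)).
- apply: near_all => u p pab; apply: (@has_deriv_Rintegral _ (fun u q => G u p q) (fun u q => G' u p q)).
  + apply: (@cont_comp _ _ _ (fun w : R * R * R => G w.1.1 w.1.2 w.2) (fun w : R * R => (w.1, p, w.2))) => //.
    by cont.
  + apply: (@cont_comp _ _ _ (fun w : R * R * R => G' w.1.1 w.1.2 w.2) (fun w : R * R => (w.1, p, w.2))) => //.
    by cont.
  + by apply: near_all => v q qab; exact: dG.
Qed.

Definition Rint2 (L : R) (g : R -> R -> R) : R :=
  \int[mu]_(p in `[0, L]) \int[mu]_(q in `[0, L]) g p q.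

Lemma continuous_Rint_snd L (g : R -> R -> R) : continuous (fun w : R * R => g w.1 w.2) ->
  continuous (fun p => \int[mu]_(q in `[0, L]) g p q).
Proof. exact: (@continuous_Rintegral _ R (fun w : R * R => g w.1 w.2)). Qed.

Lemma continuous_sec (g : R -> R -> R) p : continuous (fun w : R * R => g w.1 w.2) ->
  continuous (g p).
Proof. exact: (@continuous_pair2 _ _ _ (fun w : R * R => g w.1 w.2)). Qed.

Lemma Rint2D L (g h : R -> R -> R) : continuous (fun w : R * R => g w.1 w.2) ->
  continuous (fun w : R * R => h w.1 w.2) ->
  Rint2 L (fun p q => g p q + h p q) = Rint2 L g + Rint2 L h.
Proof.
move=> cg ch; rewrite /Rint2 -RintD; [|exact: continuous_Rint_snd..].
by apply: eq_Rintegral => p _; rewrite RintD//; exact: continuous_sec.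
Qed.

Lemma Rint2Z L (g : R -> R -> R) (c : R) : continuous (fun w : R * R => g w.1 w.2) ->
  Rint2 L (fun p q => c * g p q) = c * Rint2 L g.
Proof.
move=> cg; rewrite /Rint2 -RintZ; last exact: continuous_Rint_snd.
by apply: eq_Rintegral => p _; rewrite RintZ//; exact: continuous_sec.
Qed.

Lemma eq_Rint2 L (g h : R -> R -> R) :
  (forall p q, 0 <= p -> 0 <= q -> g p q = h p q) -> Rint2 L g = Rint2 L h.
Proof.
move=> gh; apply: eq_Rintegral => p; rewrite inE/= in_itv/= => /andP[p0 _].
by apply: eq_Rintegral => q; rewrite inE/= in_itv/= => /andP[q0 _]; exact: gh.
Qed.

End more_derivatives.

(** * The kernel in characteristic coordinates *)

Section kernel.
Context {R : realType}.
Local Notation mu := (@lebesgue_measure R).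
Implicit Types (F : space3 R -> R).

(* In the characteristic coordinates p = y1 - x1, q = 2 t - p, the support of
   Gamma is x2^2 < zf y1 p q. *)
Definition zf (y p q : R) : R := q * ((y ^+ 3 - (y - p) ^+ 3) / 3).

Lemma zf_gt0 y p q : 0 < p -> 0 < q -> 0 < zf y p q.
Proof.
move=> p0 q0; rewrite /zf mulr_gt0//.
(* The cofactor of p is y^2 - y p + p^2/3; completing the square shows that it is positive whatever
   the sign of y. *)
have -> : (y ^+ 3 - (y - p) ^+ 3) / 3 = p * ((y - p / 2) ^+ 2 + p ^+ 2 / 12) by field.
by rewrite mulr_gt0// ltr_wpDl ?sqr_ge0// divr_gt0// exprn_gt0.
Qed.

Lemma zf0l y q : zf y 0 q = 0.
Proof. by rewrite /zf subr0 subrr mul0r mulr0. Qed.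

Lemma zf0r y p : zf y p 0 = 0.
Proof. by rewrite /zf mul0r. Qed.

Lemma zf_ge0 y p q : 0 <= p -> 0 <= q -> 0 <= zf y p q.
Proof.
rewrite le_eqVlt => /predU1P[<-|p0]; first by rewrite zf0l.
rewrite le_eqVlt => /predU1P[<-|q0]; first by rewrite zf0r.
by rewrite ltW// zf_gt0.
Qed.

(** The factor r/(2k+1) of [circ_derr] cancels the 1/(2r) from the square root, so the formula has
    no radius in a denominator. It therefore also makes sense when [z] is identically 0, the
    situation on the edges of the quadrant. *)
Lemma has_deriv_circ_sqrt k F (al be z : R -> R) (s0 da db dz x : R) : smooth F ->
  continuous be -> continuous z ->
  has_deriv al s0 da -> has_deriv be s0 db -> has_deriv z s0 dz ->
  0 < z s0 \/ (forall s, z s = 0) ->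
  has_deriv (fun s => circ k F (al s) (be s) x (Num.sqrt (z s))) s0
    (circ k (pd Ct F) (al s0) (be s0) x (Num.sqrt (z s0)) * da +
    (circ k (pd Cx1 F) (al s0) (be s0) x (Num.sqrt (z s0)) * db +
    dz / (2 * (k.*2.+1)%:R) *
    circ k.+1 (pd Cx2 (pd Cx2 F)) (al s0) (be s0) x (Num.sqrt (z s0)))).
Proof.
move=> sF cbe cz dal dbe ddz zz.
have cFt := smooth_continuous (smooth_pd Ct sF).
have cF1 := smooth_continuous (smooth_pd Cx1 sF).
(* The time argument is split off first and the x1 argument next; only the dependence on the radius
   then remains. *)
apply: (@has_deriv_chain _ (fun u s => circ k F u (be s) x (Num.sqrt (z s)))
  (fun u s => circ k (pd Ct F) u (be s) x (Num.sqrt (z s)))) => //.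
- by move=> u s; exact: circ_dert.
- by apply: (@cont_circ _ (R * R)%type) => //; cont.
apply: (@has_deriv_chain _ (fun u s => circ k F (al s0) u x (Num.sqrt (z s)))
  (fun u s => circ k (pd Cx1 F) (al s0) u x (Num.sqrt (z s)))) => //.
- by move=> u s; exact: circ_der1.
- by apply: (@cont_circ _ (R * R)%type) => //; cont.
case: zz => [z0|z0]; last first.
  have -> : z = fun=> 0 by apply/funext.
  have -> : dz = 0.
    apply: (@has_deriv_unique _ z s0) => //.
    by have -> : z = fun=> 0 by [apply/funext]; exact: has_deriv_cst.
  by rewrite !mul0r; exact: has_deriv_cst.
have ds : has_deriv (fun s => Num.sqrt (z s)) s0 ((2 * Num.sqrt (z s0))^-1 * dz).
  by apply: (@has_deriv_comp _ Num.sqrt z) => //; exact: is_derive1_sqrt.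
apply: has_deriv_eq; first exact: (has_deriv_comp (circ_derr k _ _ _ _ sF) ds).
have r0 : Num.sqrt (z s0) != 0 by rewrite gt_eqF// sqrtr_gt0.
have n0 : (k.*2.+1)%:R != 0 :> R by rewrite pnatr_eq0.
move: (Num.sqrt (z s0)) r0 (k.*2.+1)%:R n0 => r r0 n n0.
by field; rewrite n0 r0.
Qed.

(** The angular integral inside psi of the overview, weighted by cos^(2k). *)
Definition Ker k F (t y x p q : R) : R :=
  circ k F (t + (p + q) / 2) (y - p) x (Num.sqrt (zf y p q)).

Lemma cont_Ker (U : topologicalType) k F (t y x p q : U -> R) : continuous F ->
  continuous t -> continuous y -> continuous x -> continuous p -> continuous q ->
  continuous (fun u => Ker k F (t u) (y u) (x u) (p u) (q u)).
Proof. by move=> *; apply: cont_circ => //; rewrite /zf; cont. Qed.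

End kernel.

Ltac contK := move=> /=; repeat first [cont1
  | lazymatch goal with
    |- continuous (fun u => Ker _ _ _ _ _ _ _) => apply: cont_Ker => // end].

Section kernel_derivatives.
Context {R : realType}.
Local Notation mu := (@lebesgue_measure R).
Implicit Types (F : space3 R -> R).

Lemma Ker_cases (y p q : R) : 0 <= p -> 0 <= q ->
  0 < zf y p q \/ (p = 0 \/ q = 0).
Proof.
rewrite le_eqVlt => /predU1P[<-|p0]; first by right; left.
rewrite le_eqVlt => /predU1P[<-|q0]; first by right; right.
by left; exact: zf_gt0.
Qed.

Lemma Ker_dert k F t y x p q : smooth F ->
  has_deriv (fun s => Ker k F s y x p q) t (Ker k (pd Ct F) t y x p q).
Proof.
move=> sF; apply: has_deriv_eq.
  apply: (@has_deriv_comp _ (fun u => circ k F u (y - p) x (Num.sqrt (zf y p q)))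
    (fun s => s + (p + q) / 2)); first exact: circ_dert.
  by apply: has_derivD; [exact: has_deriv_id|exact: has_deriv_cst].
by rewrite addr0 mulr1.
Qed.

Lemma Ker_der2 k F t y x p q : smooth F ->
  has_deriv (fun s => Ker k F t y s p q) x (Ker k (pd Cx2 F) t y x p q).
Proof. by move=> sF; exact: circ_der2. Qed.

Let deriv_zfy (y p q : R) : has_deriv (fun s => zf s p q) y (2 * y * p * q - p ^+ 2 * q).
Proof.
apply: has_deriv_eq.
  apply: has_derivZ; apply: has_derivM; last exact: has_deriv_cst.
  apply: has_derivD; first by apply: has_derivX; exact: has_deriv_id.
  by apply: has_derivN; apply: has_derivX; apply: has_derivD; [exact: has_deriv_id|exact: has_deriv_cst].
by rewrite /=; field.
Qed.

(** The closed quadrant is allowed: on p = 0 or q = 0 the radius vanishes for every y, which is the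
    second alternative of [has_deriv_circ_sqrt]. The numerator is d_y z = q (y^2 - (y - p)^2). *)
Lemma Ker_der1 k F t y x p q : smooth F -> 0 <= p -> 0 <= q ->
  has_deriv (fun s => Ker k F t s x p q) y (Ker k (pd Cx1 F) t y x p q +
   (2 * y * p * q - p ^+ 2 * q) / (2 * (k.*2.+1)%:R) *
   Ker k.+1 (pd Cx2 (pd Cx2 F)) t y x p q).
Proof.
move=> sF p0 q0; apply: has_deriv_eq.
  apply: (@has_deriv_circ_sqrt R k F (fun=> t + (p + q) / 2) (fun s => s - p) (fun s => zf s p q) _ _ _ _ _ sF).
  - by cont.
  - by rewrite /zf; cont.
  - exact: has_deriv_cst.
  - by apply: has_derivD; [exact: has_deriv_id|exact: has_deriv_cst].
  - exact: deriv_zfy.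
  - case: (Ker_cases y p0 q0) => [|[]->]; first by left.
      by right => s; rewrite zf0l.
    by right => s; rewrite zf0r.
by rewrite mulr0 add0r addr0 mulr1.
Qed.

(** Here q (y - p)^2 is d_p z. The edge p = 0 is excluded because z vanishes there without vanishing
    nearby; q = 0 is harmless, since z is then 0 for all p. *)
Lemma Ker_derp k F t y x p q : smooth F -> 0 < p -> 0 <= q ->
  has_deriv (fun s => Ker k F t y x s q) p (2^-1 * Ker k (pd Ct F) t y x p q +
    ((-1) * Ker k (pd Cx1 F) t y x p q +
   q * (y - p) ^+ 2 / (2 * (k.*2.+1)%:R) *
   Ker k.+1 (pd Cx2 (pd Cx2 F)) t y x p q)).
Proof.
move=> sF p0 q0; apply: has_deriv_eq.
  apply: (@has_deriv_circ_sqrt R k F (fun s => t + (s + q) / 2) (fun s => y - s) (fun s => zf y s q) _ _ _ _ _ sF).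
  - by cont.
  - by rewrite /zf; cont.
  - apply: has_derivD; first exact: has_deriv_cst.
    apply: has_derivM; last exact: has_deriv_cst.
    by apply: has_derivD; [exact: has_deriv_id|exact: has_deriv_cst].
  - by apply: has_derivD; [exact: has_deriv_cst|apply: has_derivN; exact: has_deriv_id].
  - apply: has_derivZ; apply: has_derivM; last exact: has_deriv_cst.
    apply: has_derivD; first exact: has_deriv_cst.
    apply: has_derivN; apply: has_derivX; apply: has_derivD; first exact: has_deriv_cst.
    by apply: has_derivN; exact: has_deriv_id.
  - case: (Ker_cases y (ltW p0) q0) => [|[|->]]; first by left.
      by move=> p00; rewrite p00 ltxx in p0.
    by right => s; rewrite zf0r.
rewrite /Ker.
set A := circ _ _ _ _ _ _; set B := circ _ _ _ _ _ _; set C := circ _ _ _ _ _ _.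
have n0 : (k.*2.+1)%:R != 0 :> R by rewrite pnatr_eq0.
move: A B C (k.*2.+1)%:R n0 => /= A B C n n0.
by field; rewrite n0.
Qed.

Lemma Ker_derq k F t y x p q : smooth F -> 0 <= p -> 0 < q ->
  has_deriv (fun s => Ker k F t y x p s) q (2^-1 * Ker k (pd Ct F) t y x p q +
   ((y ^+ 3 - (y - p) ^+ 3) / 3) / (2 * (k.*2.+1)%:R) *
   Ker k.+1 (pd Cx2 (pd Cx2 F)) t y x p q).
Proof.
move=> sF p0 q0; apply: has_deriv_eq.
  apply: (@has_deriv_circ_sqrt R k F (fun s => t + (p + s) / 2) (fun s => y - p) (fun s => zf y p s) _ _ _ _ _ sF).
  - by cont.
  - by rewrite /zf; cont.
  - apply: has_derivD; first exact: has_deriv_cst.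
    apply: has_derivM; last exact: has_deriv_cst.
    by apply: has_derivD; [exact: has_deriv_cst|exact: has_deriv_id].
  - exact: has_deriv_cst.
  - by apply: has_derivM; [exact: has_deriv_id|exact: has_deriv_cst].
  - case: (Ker_cases y p0 (ltW q0)) => [|[->|]]; first by left.
      by right => s; rewrite zf0l.
    by move=> q00; rewrite q00 ltxx in q0.
rewrite /Ker.
set A := circ _ _ _ _ _ _; set B := circ _ _ _ _ _ _; set C := circ _ _ _ _ _ _.
have n0 : (k.*2.+1)%:R != 0 :> R by rewrite pnatr_eq0.
move: A B C (k.*2.+1)%:R n0 => /= A B C n n0.
by field; rewrite n0.
Qed.

Variable L : R.

(** The monomial weights make this family stable under differentiation: d_y z is a polynomial in y,
    p and q, so each derivative is a combination of members of the family. *)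
Definition J k j l F (w : space3 R) : R :=
  Rint2 L (fun p q => p ^+ j * q ^+ l * Ker k F w.1.1 w.1.2 w.2 p q).

Lemma cont_J k j l F : continuous F -> continuous (J k j l F).
Proof.
move=> cF.
apply: (@continuous_Rintegral _ _ (fun w : space3 R * R => \int[mu]_(q in `[0, L])
   (w.2 ^+ j * q ^+ l * Ker k F w.1.1.1 w.1.1.2 w.1.2 w.2 q))).
apply: (@continuous_Rintegral _ _ (fun w : space3 R * R * R =>
   (w.1.2 ^+ j * w.2 ^+ l * Ker k F w.1.1.1.1 w.1.1.1.2 w.1.1.2 w.1.2 w.2))).
by contK.
Qed.

Lemma J_dert k j l F t y x : smooth F ->
  has_deriv (fun s => J k j l F (s, y, x)) t (J k j l (pd Ct F) (t, y, x)).
Proof.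
move=> sF; have cF := smooth_continuous sF.
have cFt := smooth_continuous (smooth_pd Ct sF).
apply: (@has_deriv_Rintegral2 _ (fun s p q => p ^+ j * q ^+ l * Ker k F s y x p q)
  (fun s p q => p ^+ j * q ^+ l * Ker k (pd Ct F) s y x p q)).
- by contK.
- by contK.
- by move=> u p q _ _; apply: has_derivZ; exact: Ker_dert.
Qed.

Lemma J_der2 k j l F t y x : smooth F ->
  has_deriv (fun s => J k j l F (t, y, s)) x (J k j l (pd Cx2 F) (t, y, x)).
Proof.
move=> sF; have cF := smooth_continuous sF.
have cFt := smooth_continuous (smooth_pd Cx2 sF).
apply: (@has_deriv_Rintegral2 _ (fun s p q => p ^+ j * q ^+ l * Ker k F t y s p q)
  (fun s p q => p ^+ j * q ^+ l * Ker k (pd Cx2 F) t y s p q)).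
- by contK.
- by contK.
- by move=> u p q _ _; apply: has_derivZ; exact: Ker_der2.
Qed.

Lemma J_der1 k j l F t y x : smooth F ->
  has_deriv (fun s => J k j l F (t, s, x)) y (J k j l (pd Cx1 F) (t, y, x) +
   (y / (k.*2.+1)%:R * J k.+1 j.+1 l.+1 (pd Cx2 (pd Cx2 F)) (t, y, x) +
   - (2 * (k.*2.+1)%:R)^-1 *
     J k.+1 j.+2 l.+1 (pd Cx2 (pd Cx2 F)) (t, y, x))).
Proof.
move=> sF; have cF := smooth_continuous sF.
have cF1 := smooth_continuous (smooth_pd Cx1 sF).
have cFxx := smooth_continuous (smooth_pd Cx2 (smooth_pd Cx2 sF)).
set Fxx := pd Cx2 (pd Cx2 F).
have n0 : (k.*2.+1)%:R != 0 :> R by rewrite pnatr_eq0.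
have cw j' l' k' G u : continuous G ->
    continuous (fun w : R * R => w.1 ^+ j' * w.2 ^+ l' * Ker k' G t u x w.1 w.2).
  by move=> cG; contK.
rewrite /J -!Rint2Z; [|exact: cw..].
rewrite -!Rint2D; [|by contK..].
apply: (@has_deriv_Rintegral2 _ (fun s p q => p ^+ j * q ^+ l * Ker k F t s x p q)
  (fun y p q => p ^+ j * q ^+ l * Ker k (pd Cx1 F) t y x p q +
    (y / k.*2.+1%:R * (p ^+ j.+1 * q ^+ l.+1 * Ker k.+1 Fxx t y x p q) +
     - (2 * k.*2.+1%:R)^-1 * (p ^+ j.+2 * q ^+ l.+1 * Ker k.+1 Fxx t y x p q)))).
- by contK.
- by contK.
- move=> u p q; rewrite !in_itv/= => /andP[p0 _] /andP[q0 _].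
  apply: has_deriv_eq; first by apply: has_derivZ; exact: Ker_der1.
  rewrite !exprS -/Fxx.
  move: (Ker _ _ _ _ _ _ _) (Ker _ Fxx _ _ _ _ _) (k.*2.+1)%:R n0 => A B n n0.
  by field; rewrite n0.
Qed.

End kernel_derivatives.

(** * Smoothness of the potential and the wave equation *)

Section finite_order.
Context {R : realType}.
Implicit Types (f g : space3 R -> R) (c : coordinate) (n : nat).

(** The recursion peels off the innermost derivative, so regularity of a function reduces to that of
    explicit formulas for its first partial derivatives. In [iter_partial] the head of the list is
    the outermost derivative instead. *)
Fixpoint Cn n f : Prop :=
  if n is n'.+1 then
    continuous f /\ forall c, (forall z, derivable f z (unit_vector R c)) /\ Cn n' (pd c f)
  else continuous f.

Lemma smooth_Cn n f : smooth f -> Cn n f.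
Proof.
elim: n f => [|n IH] f sf /=; first exact: smooth_continuous.
split; first exact: smooth_continuous.
by move=> c; split; [have [_] := sf [::]; apply|apply: IH; exact: smooth_pd].
Qed.

Lemma Cn_smooth f : (forall n, Cn n f) -> smooth f.
Proof.
(* One order more than [size s] is needed for derivability of the iterated derivative. The induction
   is from the right end of [s], since [foldr] applies the last coordinate first. *)
move=> h s; move: (h (size s).+1) => {h}.
elim/last_ind: s f => [|s c IH] f; first by move=> [cf df]; split=> // c z; have [] := df c.
rewrite size_rcons => -[_ /(_ c)[_]] /IH.
by rewrite /iter_partial foldr_rcons pdE.
Qed.

Lemma CnS n f : Cn n.+1 f -> Cn n f.
Proof.
elim: n f => [|n IH] f; first by case.
by move=> [cf df]; split => // c; have [? ?] := df c; split => //; exact: IH.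
Qed.

Lemma Cn_intro n f (g : coordinate -> space3 R -> R) : continuous f ->
  (forall c z, has_deriv (fun s => f (line c z s)) (coord_of c z) (g c z)) ->
  (forall c, Cn n (g c)) -> Cn n.+1 f.
Proof.
move=> cf dg Cg; split => // c; split.
  by move=> z; have /is_derive_coord h := dg c z; apply: (@ex_derive _ _ _ _ _ _ _ h).
by have -> : pd c f = g c by apply/funext => z; exact: pd_eq.
Qed.

Lemma CnD n f g : Cn n f -> Cn n g -> Cn n (fun z => f z + g z).
Proof.
elim: n f g => [|n IH] f g; first exact: contD.
move=> [cf df] [cg dg]; split; first exact: contD.
move=> c; have [df1 Cf] := df c; have [dg1 Cg] := dg c.
split; first by move=> z; exact: derivableD.
have -> : pd c (fun z => f z + g z) = (fun z => pd c f z + pd c g z).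
  by apply/funext => z; rewrite !pdE /partial_deriv; exact: deriveD.
exact: IH.
Qed.

Lemma CnM n f g : Cn n f -> Cn n g -> Cn n (fun z => f z * g z).
Proof.
elim: n f g => [|n IH] f g; first exact: contM.
move=> Hf Hg; have Hf' := CnS Hf; have Hg' := CnS Hg.
move: Hf Hg => [cf df] [cg dg]; split; first exact: contM.
move=> c; have [df1 Cf] := df c; have [dg1 Cg] := dg c.
split; first by move=> z; exact: derivableM.
have -> : pd c (fun z => f z * g z) = (fun z => f z * pd c g z + g z * pd c f z).
  by apply/funext => z; rewrite !pdE /partial_deriv; exact: deriveM.
by apply: CnD; apply: IH.
Qed.

Lemma Cn_cst n (a : R) : Cn n (fun=> a).
Proof.
elim: n a => [|n IH] a; first exact: cont_cst.
apply: (@Cn_intro _ _ (fun _ _ => 0)) => //; first exact: cont_cst.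
by move=> c z; exact: has_deriv_cst.
Qed.

Lemma Cn_x1 n : Cn n (fun z : space3 R => z.1.2).
Proof.
have cx : continuous (fun z : space3 R => z.1.2) by cont.
case: n => [|n] //.
apply: (@Cn_intro _ _ (fun c _ => if c is Cx1 then 1 else 0)) => //.
  by move=> [] z /=; [exact: has_deriv_cst|exact: has_deriv_id|exact: has_deriv_cst].
by case; exact: Cn_cst.
Qed.

Lemma smoothD f g : smooth f -> smooth g -> smooth (fun z => f z + g z).
Proof. by move=> sf sg; apply: Cn_smooth => n; apply: CnD; exact: smooth_Cn. Qed.

Lemma smoothM f g : smooth f -> smooth g -> smooth (fun z => f z * g z).
Proof. by move=> sf sg; apply: Cn_smooth => n; apply: CnM; exact: smooth_Cn. Qed.

Lemma smooth_cst (a : R) : smooth (fun=> a).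
Proof. by apply: Cn_smooth => n; exact: Cn_cst. Qed.

Lemma smooth_x1 : smooth (fun z : space3 R => z.1.2).
Proof. by apply: Cn_smooth => n; exact: Cn_x1. Qed.

(** The induction is over all indices and all smooth [f] at once, because the derivative in y raises
    [k], [j] and [l] and replaces [f] by its second x2-derivative. *)
Lemma Cn_J L n k j l f : smooth f -> Cn n (J L k j l f).
Proof.
elim: n k j l f => [|n IH] k j l f sf.
  by apply: cont_J; exact: smooth_continuous.
pose fxx := pd Cx2 (pd Cx2 f).
apply: (@Cn_intro _ _ (fun c => match c with
  | Ct => J L k j l (pd Ct f)
  | Cx1 => fun z => J L k j l (pd Cx1 f) z +
     (z.1.2 * (k.*2.+1)%:R^-1 * J L k.+1 j.+1 l.+1 fxx z +
      - (2 * (k.*2.+1)%:R)^-1 * J L k.+1 j.+2 l.+1 fxx z)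
  | Cx2 => J L k j l (pd Cx2 f) end)).
- by apply: cont_J; exact: smooth_continuous.
- by case=> -[[t y] x] /=; [exact: J_dert|exact: J_der1|exact: J_der2].
- have sxx : smooth fxx by do 2 apply: smooth_pd.
  case; [by apply: IH; exact: smooth_pd| |by apply: IH; exact: smooth_pd].
  apply: CnD; first by apply: IH; exact: smooth_pd.
  apply: CnD; apply: CnM; [|exact: IH|exact: Cn_cst|exact: IH].
  by apply: CnM; [exact: Cn_x1|exact: Cn_cst].
Qed.

Lemma smooth_J L k j l f : smooth f -> smooth (J L k j l f).
Proof. by move=> sf; apply: Cn_smooth => n; exact: Cn_J. Qed.

Lemma smooth_derivable c f z : smooth f -> derivable f z (unit_vector R c).
Proof. by move=> sf; have [_] := sf [::]; apply. Qed.

Lemma pdM c f g : smooth f -> smooth g ->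
  pd c (fun z => f z * g z) = (fun z => f z * pd c g z + g z * pd c f z).
Proof.
move=> sf sg; apply/funext => z; rewrite !pdE /partial_deriv.
by apply: deriveM; exact: smooth_derivable.
Qed.

Lemma pd_cst c (a : R) : pd c (fun=> a) = (fun=> 0).
Proof. by apply/funext => z; apply: pd_eq; exact: has_deriv_cst. Qed.

End finite_order.

(** * The potential inverts the wave operator on both sides *)

Section identity.
Context {R : realType}.
Local Notation mu := (@lebesgue_measure R).
Implicit Types (F : space3 R -> R).

Definition vanish_after (T : R) F := forall z, T < z.1.1 -> F z = 0.

Lemma vanish_after_pd T c F : vanish_after T F -> vanish_after T (pd c F).
Proof.
move=> vF z Tz; apply: pd_eq.
apply: (has_deriv_near _ (has_deriv_cst 0 _)).
case: c; last 2 first.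
- by apply: near_all => s; rewrite vF.
- by apply: near_all => s; rewrite vF.
exists (z.1.1 - T) => /=; first by rewrite subr_gt0.
move=> s /=; rewrite ltr_norml => /andP[_ hs]; rewrite vF//=; lra.
Qed.

Lemma Ker_vanish T k F t y x p q : vanish_after T F -> T < t + (p + q) / 2 ->
  Ker k F t y x p q = 0.
Proof.
move=> vF Tt; rewrite /Ker circE; under eq_Rintegral do rewrite vF// mulr0.
by rewrite Rintegral_cst// mul0r.
Qed.

(** Hypothesis [Tt] places the edges p = L and q = L of the square at times above [T], where the
    kernels vanish; the square thus stands for the whole quadrant. *)
Variables (L T t y x : R) (F : space3 R -> R).
Hypotheses (L0 : 0 <= L) (sF : smooth F) (vF : vanish_after T F) (Tt : T < t + L / 2).

Let Ft := pd Ct F.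
Let Fxx := pd Cx2 (pd Cx2 F).

Let sFt : smooth Ft. Proof. exact: smooth_pd. Qed.
Let sFxx : smooth Fxx. Proof. by do 2 apply: smooth_pd. Qed.

(* The p-derivative of Ker 0 F_t and the q-derivative of 2 q Ker 1 F_xx. *)
Definition dKerp (p q : R) : R := 2^-1 * Ker 0 (pd Ct Ft) t y x p q +
    ((-1) * Ker 0 (pd Cx1 Ft) t y x p q +
   q * (y - p) ^+ 2 / 2 * Ker 1 (pd Cx2 (pd Cx2 Ft)) t y x p q).

Definition dKerq (p q : R) : R :=
  Ker 0 Fxx t y x p q + q * Ker 1 (pd Ct Fxx) t y x p q.

Lemma cont_dKerp : continuous (fun w : R * R => dKerp w.1 w.2).
Proof.
have c1 := smooth_continuous (smooth_pd Ct sFt).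
have c2 := smooth_continuous (smooth_pd Cx1 sFt).
have c3 := smooth_continuous (smooth_pd Cx2 (smooth_pd Cx2 sFt)).
by rewrite /dKerp; contK.
Qed.

Lemma cont_dKerq : continuous (fun w : R * R => dKerq w.1 w.2).
Proof.
have c1 := smooth_continuous sFxx.
have c2 := smooth_continuous (smooth_pd Ct sFxx).
by rewrite /dKerq; contK.
Qed.

(** Integration in p leaves the boundary term at p = 0 only. The radius is 0 there, so the kernel is
    pi F_t(t + q/2, y, x), and integration in q gives -2 pi F(t, y, x). *)
Lemma Rint2_dKerp : Rint2 L dKerp = 2 * pi * F (t, y, x).
Proof.
have cFt := smooth_continuous sFt.
have cF := smooth_continuous sF.
pose A p := \int[mu]_(q in `[0, L]) Ker 0 Ft t y x p q.
have cK : continuous (fun w : R * R => Ker 0 Ft t y x w.1 w.2) by contK.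
rewrite /Rint2 (@Rintegral_FTC _ A)//; last 3 first.
- by apply: (@continuous_Rint_snd _ L dKerp); exact: cont_dKerp.
- exact: (@continuous_Rint_snd _ L (fun p q => Ker 0 Ft t y x p q)).
- move=> p; rewrite in_itv/= => /andP[p0 pL].
  apply: (@has_deriv_Rintegral _ (fun p q => Ker 0 Ft t y x p q) dKerp) => //.
    exact: cont_dKerp.
  (* A neighbourhood of radius [p] stays in the region p > 0 required by [Ker_derp]. *)
  exists p => //= u /=; rewrite ltr_norml => /andP[_ up] q.
  rewrite in_itv/= => /andP[q0 _].
  apply: has_deriv_eq; first by apply: Ker_derp => //; lra.
  by rewrite /dKerp mulr1.
have -> : A L = 0.
  rewrite /A (@eq_Rintegral _ _ _ _ _ (fun=> 0)) ?Rintegral_cst ?mul0r//.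
  move=> q; rewrite inE/= in_itv/= => /andP[q0 _].
  apply: (@Ker_vanish T); first exact: vanish_after_pd.
  by rewrite (lt_le_trans Tt)// lerD2l ler_pM2r ?invr_gt0// lerDl.
have -> : A 0 = \int[mu]_(q in `[0, L]) (2 * pi * (2^-1 * Ft (t + q / 2, y, x))).
  apply: eq_Rintegral => q _; rewrite /Ker zf0l sqrtr0 circ0 subr0 add0r.
  by field.
rewrite RintZ; last by cont.
rewrite (@Rintegral_FTC _ (fun q => F (t + q / 2, y, x)))//.
- by rewrite vF//= mul0r addr0; ring.
- by cont.
- by cont.
- move=> q _; apply: has_deriv_eq.
    apply: (@has_deriv_comp _ (fun u => F (u, y, x)) (fun q => t + q / 2)).
      exact: smooth_dert.
    by apply: (has_derivD (has_deriv_cst t q)); apply: has_derivM; [exact: has_deriv_id|exact: has_deriv_cst].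
  by rewrite mul1r mulr0 addr0 add0r mulrC.
Qed.

(** The antiderivative 2 q M_1 F_xx vanishes at q = 0 by its factor q and at q = L by support. *)
Lemma Rint_dKerq p : 0 <= p -> \int[mu]_(q in `[0, L]) dKerq p q = 0.
Proof.
move=> p0; have cFxx := smooth_continuous sFxx.
rewrite (@Rintegral_FTC _ (fun q => 2 * (q * Ker 1 Fxx t y x p q)))//.
- rewrite (@Ker_vanish T); [|by do 2 apply: vanish_after_pd|].
    by rewrite mulr0 mul0r mulr0 subrr.
  by rewrite (lt_le_trans Tt)// lerD2l ler_pM2r ?invr_gt0// lerDr.
- by apply: (@continuous_sec _ dKerq); exact: cont_dKerq.
- apply: contM; first exact: cont_cst.
  apply: contM; first exact: cont_id.
  by apply: (@continuous_sec _ (fun p q => Ker 1 Fxx t y x p q)); contK.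
- move=> q; rewrite in_itv/= => /andP[q0 _].
  apply: has_deriv_eq.
    apply: has_derivZ; apply: (has_derivM (has_deriv_id q)); exact: Ker_derq.
  (* The recurrence writes M_0 F_xx through M_1 and M_2. The M_2 terms agree because z is linear in
     q, that is, q d_q z = z. *)
  rewrite /dKerq {4}/Ker circ_recurrence// sqr_sqrtr ?zf_ge0 ?(ltW q0)//.
  rewrite -/(Ker 1 Fxx t y x p q) -/(Ker 2 (pd Cx2 (pd Cx2 Fxx)) t y x p q) /zf /=.
  move: (Ker _ _ _ _ _ _ _) (Ker 1 (pd Ct Fxx) _ _ _ _ _) (Ker 2 _ _ _ _ _ _) => A B C.
  rewrite (_ : 1.*2.+1%:R = 3 :> R)//.
  by field.
Qed.

(** The weight depends on p alone, so it leaves the q-integral, which is 0. The freedom in [w]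
    serves both inversions: y^2 for [wave_psi] and (y - p)^2 for [psi_wave]. *)
Lemma core_identity (w : R -> R) : continuous w ->
  Rint2 L (fun p q => 2 * dKerp p q + (-1) * (w p * dKerq p q)) = 4 * pi * F (t, y, x).
Proof.
move=> cw; have cp := cont_dKerp; have cq := cont_dKerq.
have cwq : continuous (fun z : R * R => w z.1 * dKerq z.1 z.2) by apply: contM => //; cont.
rewrite Rint2D; [|by apply: contM; [cont|]..].
rewrite !Rint2Z// Rint2_dKerp.
rewrite /Rint2 (@eq_Rintegral _ _ _ _ _ (fun=> 0)).
  by rewrite Rintegral_cst// mul0r mulr0 addr0; ring.
move=> p; rewrite inE/= in_itv/= => /andP[p0 _].
rewrite RintZ; last exact: continuous_sec.
by rewrite Rint_dKerq// mulr0.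
Qed.

(** The order of d_x1 and d_t is the one that transposing [wave_op] produces, so these two
    derivatives never have to be interchanged. *)
Definition wave F : space3 R -> R := fun z =>
  pd Ct (pd Ct F) z - 2 * pd Cx1 (pd Ct F) z - z.1.2 ^+ 2 * pd Cx2 (pd Cx2 F) z.

Definition psi (L : R) F (z : space3 R) : R := (4 * pi)^-1 * J L 0 0 0 F z.

Lemma J000E G : J L 0 0 0 G (t, y, x) = Rint2 L (Ker 0 G t y x).
Proof. by apply: eq_Rint2 => p q _ _; rewrite !expr0 !mul1r. Qed.

Let schwarz_txx : pd Ct Fxx = pd Cx2 (pd Cx2 Ft).
Proof. by rewrite /Fxx -(schwarz (smooth_pd Cx2 sF)) -(schwarz sF). Qed.

(** With weight y^2, the term -2 d_y d_t adds -(2 y p q - p^2 q) M_1 F_txx, and this coefficient is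
    exactly q (y - p)^2 - q y^2, the one left by [dKerp] and [dKerq]. *)
Lemma wave_psi : wave (psi L F) (t, y, x) = F (t, y, x).
Proof.
rewrite /wave /=.
have pd_psi_t G : smooth G -> pd Ct (psi L G) = psi L (pd Ct G).
  move=> sG; apply/funext => -[[u v] w]; apply: pd_eq.
  by apply: has_derivZ; exact: J_dert.
have pd_psi_2 G : smooth G -> pd Cx2 (psi L G) = psi L (pd Cx2 G).
  move=> sG; apply/funext => -[[u v] w]; apply: pd_eq.
  by apply: has_derivZ; exact: J_der2.
have sFx := smooth_pd Cx2 sF.
rewrite (pd_psi_t _ sF) (pd_psi_t _ sFt) (pd_psi_2 _ sF) (pd_psi_2 _ sFx).
have -> : pd Cx1 (psi L Ft) (t, y, x) = (4 * pi)^-1 * (J L 0 0 0 (pd Cx1 Ft) (t, y, x) +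
   (y / 1%:R * J L 1 1 1 (pd Cx2 (pd Cx2 Ft)) (t, y, x) +
   - (2 * 1%:R)^-1 * J L 1 2 1 (pd Cx2 (pd Cx2 Ft)) (t, y, x))).
  by apply: pd_eq; apply: has_derivZ; exact: J_der1.
rewrite /psi.
have pi0 : pi != 0 :> R by rewrite gt_eqF// pi_gt0.
have c1 := smooth_continuous (smooth_pd Ct sFt).
have c2 := smooth_continuous (smooth_pd Cx1 sFt).
have c3 := smooth_continuous (smooth_pd Cx2 (smooth_pd Cx2 sFt)).
have c4 := smooth_continuous sFxx.
have E : J L 0 0 0 (pd Ct Ft) (t, y, x) + ((-2) * J L 0 0 0 (pd Cx1 Ft) (t, y, x) +
   ((-2 * y) * J L 1 1 1 (pd Cx2 (pd Cx2 Ft)) (t, y, x) +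
    (1 * J L 1 2 1 (pd Cx2 (pd Cx2 Ft)) (t, y, x) +
     (- y ^+ 2) * J L 0 0 0 Fxx (t, y, x)))) = 4 * pi * F (t, y, x).
  rewrite !J000E /J -!Rint2Z; [|by contK..].
  rewrite -!Rint2D; [|by contK..].
  rewrite -(core_identity (@cont_cst R R (y ^+ 2))).
  apply: eq_Rint2 => p q p0 q0; rewrite /dKerp /dKerq schwarz_txx !expr1 /=.
  move: (Ker _ (pd Ct Ft) _ _ _ _ _) (Ker _ (pd Cx1 Ft) _ _ _ _ _) => A B.
  move: (Ker _ (pd Cx2 _) _ _ _ _ _) (Ker _ Fxx _ _ _ _ _) => C D.
  by field.
have pi4 : 4 * pi != 0 :> R by rewrite mulf_neq0.
apply: (mulfI pi4); rewrite -E => {E}.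
move: (4 * pi) pi4 => P P0.
move: (J _ _ _ _ _ _) (J _ _ _ _ (pd Cx1 Ft) _) (J _ _ _ _ Fxx _)
  (J _ 1 1 1 _ _) (J _ 1 2 1 _ _) => A B C D E'.
by field.
Qed.

(** Inside the kernel the coefficient x1^2 is evaluated at y - p, hence the weight (y - p)^2; the
    two terms in q (y - p)^2 M_1 F_txx then cancel. *)
Lemma psi_wave :
  psi L (wave F) (t, y, x) = F (t, y, x).
Proof.
rewrite /psi J000E /wave.
have pi0 : pi != 0 :> R by rewrite gt_eqF// pi_gt0.
have c1 := smooth_continuous (smooth_pd Ct sFt).
have c2 := smooth_continuous (smooth_pd Cx1 sFt).
have c4 := smooth_continuous sFxx.
have cw : continuous (fun p => (y - p) ^+ 2) by cont.
apply: (@mulfI _ (4 * pi)); first by rewrite mulf_neq0.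
rewrite mulVKf ?mulf_neq0// -(core_identity cw).
apply: eq_Rint2 => p q p0 q0; rewrite /dKerp /dKerq schwarz_txx.
have -> : Ker 0 (fun z => pd Ct Ft z - 2 * pd Cx1 Ft z - z.1.2 ^+ 2 * Fxx z) t y x p q =
   Ker 0 (pd Ct Ft) t y x p q + ((-2) * Ker 0 (pd Cx1 Ft) t y x p q +
   (- (y - p) ^+ 2) * Ker 0 Fxx t y x p q).
  rewrite /Ker !circE -!RintZ; [|by cont..]; rewrite -!RintD; [|by cont..].
  by apply: eq_Rintegral => s _ /=; ring.
move: (Ker _ (pd Ct Ft) _ _ _ _ _) (Ker _ (pd Cx1 Ft) _ _ _ _ _) => A B.
move: (Ker _ (pd Cx2 _) _ _ _ _ _) (Ker _ Fxx _ _ _ _ _) => C D.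
by field.
Qed.

End identity.

(** * Integration against Gamma *)

Section measurability.
Context {R : realType}.
Let M3 := (measurableTypeR R * measurableTypeR R * measurableTypeR R)%type.

(** An open set is a countable union of boxes with rational centres and radii 1/(n+1), and boxes lie
    in the product sigma-algebra. *)
Lemma measurable_open3 (O : set (space3 R)) : open O -> measurable (O : set M3).
Proof.
move=> oO.
pose box (a b c : rat) (n : nat) : set M3 :=
  (ball (ratr a : R) n.+1%:R^-1 `*` ball (ratr b : R) n.+1%:R^-1) `*`
  ball (ratr c : R) n.+1%:R^-1.
have mbox a b c n : measurable (box a b c n).
  by apply: measurableX; [apply: measurableX|]; exact: measurable_ball.
(* [W] is the box if it fits into [O] and empty otherwise, so that the unions may run over all
   indices. *)
pose W a b c n : set M3 := box a b c n `&` [set _ | box a b c n `<=` (O : set M3)].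
have mW a b c n : measurable (W a b c n).
  rewrite /W; have [h|h] := pselect (box a b c n `<=` (O : set M3)).
    by rewrite (_ : _ `&` _ = box a b c n)//; apply/seteqP; split => // z [].
  by rewrite (_ : _ `&` _ = set0)//; apply/seteqP; split => // z [].
rewrite (_ : (O : set M3) = \bigcup_a \bigcup_b \bigcup_c \bigcup_n W a b c n).
  apply: bigcupT_measurable_rat => a; apply: bigcupT_measurable_rat => b.
  by apply: bigcupT_measurable_rat => c; exact: bigcupT_measurable.
apply/seteqP; split => z; last by move=> [a _ [b _ [c _ [n _ [zb h]]]]]; exact: h.
move=> Oz; have /nbhs_ballP[e /= e0 he] : nbhs (z : space3 R) O by apply: open_nbhs_nbhs.
have [n hn] : exists n : nat, 0 + n.+1%:R^-1 < e / 2.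
  by apply: ltr_add_invr; rewrite divr_gt0.
rewrite add0r in hn.
have n0 : 0 < n.+1%:R^-1 :> R by rewrite invr_gt0.
have near_rat (u : R) : exists a : rat, `|ratr a - u| < n.+1%:R^-1.
  move: (n.+1%:R^-1 : R) n0 => d d0.
  have [|a] := @rat_in_itvoo R (u - d) (u + d); first lra.
  by rewrite in_itv/= => /andP[h1 h2]; exists a; rewrite ltr_norml; apply/andP; split; lra.
have [a ha] := near_rat z.1.1; have [b hb] := near_rat z.1.2; have [c hc] := near_rat z.2.
exists a => //; exists b => //; exists c => //; exists n => //; split => //.
move=> w [[w1 w2] w3]; apply: he.
have tri (u v : R) (d : rat) : `|ratr d - u| < n.+1%:R^-1 -> ball (ratr d : R) n.+1%:R^-1 v ->
    `|u - v| < e.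
  move=> h1 h2; have -> : u - v = (ratr d - v) - (ratr d - u) by ring.
  rewrite (le_lt_trans (ler_normB _ _))// (splitr e) ltrD//.
    by apply: lt_trans hn.
  by apply: lt_trans hn.
by split; [split|]; [apply: tri w1|apply: tri w2|apply: tri w3].
Qed.

Lemma measurable_compact3 (K : set (space3 R)) : compact K -> measurable (K : set M3).
Proof.
move=> cK; rewrite -(setCK K); apply: measurableC; apply: measurable_open3.
by apply: closed_openC; apply: compact_closed => //; exact: norm_hausdorff.
Qed.

Lemma continuous_measurable3 (f : space3 R -> R) : continuous f ->
  measurable_fun setT (f : M3 -> measurableTypeR R).
Proof.
move=> /continuousP cf; apply: (measurability _ (RGenOpens.measurableE R)).
move=> _ [_ [a [b ->] <-]]; rewrite setTI; apply: measurable_open3.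
exact/cf/interval_open.
Qed.

(** Inversion is treated as the real power of exponent -1, which is where nonnegativity enters. *)
Lemma measurable_funV (d : measure_display) (T : measurableType d) (f : T -> R) :
  measurable_fun setT f -> (forall x, 0 <= f x) ->
  measurable_fun setT (fun x => (f x)^-1).
Proof.
move=> mf f0; under eq_fun do rewrite -powR_inv1//.
by apply: (measurableT_comp (measurable_powR _)).
Qed.

Lemma measurable_GammaF y1 : measurable_fun setT (GammaF y1 : M3 -> measurableTypeR R).
Proof.
have ct : measurable_fun setT ((fun z => z.1.1) : M3 -> measurableTypeR R).
  by apply: continuous_measurable3; cont.
have cx : measurable_fun setT ((fun z => z.1.2) : M3 -> measurableTypeR R).
  by apply: continuous_measurable3; cont.
pose D := fun z : space3 R => (y1 ^+ 3 - z.1.2 ^+ 3) * (2 * z.1.1 + z.1.2 - y1) - 3 * z.2 ^+ 2.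
have cD : continuous D by rewrite /D; cont.
have mD : measurable_fun setT (D : M3 -> measurableTypeR R) by exact: continuous_measurable3.
apply: measurable_fun_ifT.
- apply: measurable_and; first exact: measurable_fun_ltr.
  by apply: measurable_and; exact: measurable_fun_ltr.
- apply: measurable_funM => //; apply: measurable_funM => //.
  apply: measurable_funV => //.
  by apply: continuous_measurable3; apply: (@cont_sqrt _ _ D).
- exact: measurable_cst.
Qed.

End measurability.

(** * The substitution x = r sin th *)

Section arcsine.
Context {R : realType}.
Local Notation mu := (@lebesgue_measure R).

(** These angles increase to pi/2 without reaching it. The density is singular at the end points, so
    the substitution is made on the compact intervals [-c n, c n] and followed by a limit. *)
Let c (n : nat) : R := pi / 2 * (1 - n.+1%:R^-1).

Let c_ge0 n : 0 <= c n.
Proof.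
by rewrite mulr_ge0 ?divr_ge0 ?pi_ge0// subr_ge0 invf_le1 ?ltr0n// ler1n.
Qed.

Let c_lt n : c n < pi / 2.
Proof. by rewrite /c gtr_pMr ?divr_gt0 ?pi_gt0// ltrBlDr ltrDl invr_gt0. Qed.

Let c_le n m : (n <= m)%N -> c n <= c m.
Proof.
move=> nm; rewrite /c ler_pM2l ?divr_gt0 ?pi_gt0// lerD2l lerN2.
by rewrite lef_pV2 ?posrE// ler_nat.
Qed.

Let c_cover (x : R) : `|x| < pi / 2 -> exists n, `|x| <= c n.
Proof.
move=> xp; have p0 : 0 < pi / 2 :> R by rewrite divr_gt0 ?pi_gt0.
have [|n hn] := @ltr_add_invr R (`|x| / (pi / 2)) 1.
  by rewrite ltr_pdivrMr// mul1r.
by exists n; rewrite /c mulrC -ler_pdivrMr// lerBrDr ltW.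
Qed.

Let in_pihalf (x : R) : `|x| <= pi / 2 -> x \in `[(- (pi / 2)), pi / 2].
Proof. by rewrite in_itv/= ler_norml. Qed.

Let ler_sin' (x y : R) : `|x| <= pi / 2 -> `|y| <= pi / 2 -> x <= y -> sin x <= sin y.
Proof.
by move=> hx hy xy; rewrite leNgt ltr_sin ?in_pihalf// -leNgt.
Qed.

Let norm_c n : `|c n| <= pi / 2.
Proof. by rewrite ger0_norm// ltW. Qed.

Let B n : set R := `[- c n, c n]%classic.
Let A r n : set R := `[r * sin (- c n), r * sin (c n)]%classic.

Let B_cover : \bigcup_n B n = `]- (pi / 2), (pi / 2)[%classic.
Proof.
apply/seteqP; split => x /=.
  move=> [n _]; rewrite /B /= !in_itv/= => /andP[h1 h2].
  by have := c_lt n; move=> h3; apply/andP; split; lra.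
rewrite in_itv/= -ltr_norml => /c_cover[n]; rewrite ler_norml => hn.
by exists n => //; rewrite /B/= in_itv.
Qed.

Let A_sub r n : 0 < r -> A r n `<=` `]- r, r[%classic.
Proof.
move=> r0 x; rewrite /A/= !in_itv/= sinN mulrN => /andP[h1 h2].
have h : r * sin (c n) < r.
  rewrite gtr_pMr// -sin_pihalf ltr_sin ?c_lt//; first exact: in_pihalf.
  by apply: in_pihalf; rewrite ger0_norm// divr_ge0 ?pi_ge0.
by apply/andP; split; lra.
Qed.

Let A_cover r : 0 < r -> \bigcup_n A r n = `]- r, r[%classic.
Proof.
move=> r0; apply/seteqP; split => x; first by move=> [n _]; exact: A_sub.
rewrite /= in_itv/= => /andP[h1 h2].
have xr1 : -1 < x / r by rewrite ltr_pdivlMr// mulN1r.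
have xr2 : x / r < 1 by rewrite ltr_pdivrMr// mul1r.
have [n hn] : exists n, `|asin (x / r)| <= c n.
  apply: c_cover; rewrite ltr_norml asin_gtNpi2 ?xr1 ?(ltW xr2)//=.
  by rewrite asin_ltpi2// (ltW xr1).
have hp : `|asin (x / r)| <= pi / 2 by rewrite (le_trans hn)// ltW.
exists n => //; rewrite /A/= in_itv/=.
have -> : x = r * sin (asin (x / r)).
  by rewrite asinK ?in_itv/= ?(ltW xr1) ?(ltW xr2)// mulrC divfK// gt_eqF.
move: hn; rewrite ler_norml => /andP[hn1 hn2].
by rewrite !ler_pM2l// !ler_sin'// ?normrN.
Qed.

Let dens_cont r (g : R -> R) : continuous g ->
  {in `]- r, r[, continuous (fun x => g x / Num.sqrt (r ^+ 2 - x ^+ 2))}.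
Proof.
move=> cg x; rewrite in_itv/= => /andP[h1 h2].
have cs : continuous (fun x : R => Num.sqrt (r ^+ 2 - x ^+ 2)) by cont.
apply: cvgM; first exact: cg.
apply: cvgV; last exact: cs.
by rewrite gt_eqF// sqrtr_gt0 subr_sqr; apply: mulr_gt0; lra.
Qed.

Let dens_meas (r : R) (g : R -> R) : continuous g ->
  measurable_fun `]- r, r[ (fun x => (g x / Num.sqrt (r ^+ 2 - x ^+ 2))%:E).
Proof.
move=> cg; apply/measurable_EFinP; apply: open_continuous_measurable_fun => //.
by move=> x; rewrite inE => xr; exact: dens_cont.
Qed.

Let subst_n (r : R) (g : R -> R) n : 0 < r -> continuous g ->
  (\int[mu]_(x in A r n) (g x / Num.sqrt (r ^+ 2 - x ^+ 2))%:E =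
   \int[mu]_(th in B n) (g (r * sin th))%:E)%E.
Proof.
move=> r0 cg; pose F (th : R) := r * sin th.
have dF : F^`()%classic = (fun th => r * cos th).
  apply/funext => th; rewrite derive1E.
  by have [_] := has_derivZ r (has_deriv_sin th).
have cF : continuous F by rewrite /F; cont.
have cF' : continuous (fun th : R => r * cos th) by cont.
rewrite /A /B (@integration_by_substitution_increasing R F
  (fun x => g x / Num.sqrt (r ^+ 2 - x ^+ 2)) (- c n) (c n)).
- apply: eq_integral => th; rewrite inE/= in_itv/= => /andP[h1 h2].
  congr EFin; rewrite /= dF.
  change (g (r * sin th) / Num.sqrt (r ^+ 2 - (r * sin th) ^+ 2) * (r * cos th) =
    g (r * sin th)).
  have cth : 0 < cos th.
    by apply: cos_gt0_pihalf; have := c_lt n => h3; apply/andP; split; lra.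
  have -> : r ^+ 2 - (r * sin th) ^+ 2 = (r * cos th) ^+ 2.
    by rewrite !exprMn cos2sin2 mulrBr mulr1.
  rewrite sqrtr_sqr ger0_norm; last by rewrite mulr_ge0// ltW.
  by rewrite divfK// mulf_neq0// gt_eqF.
- by have := c_ge0 n; lra.
- move=> x y; rewrite !in_itv/= => /andP[x1 x2] /andP[y1 y2] xy.
  have := c_lt n => h3.
  by rewrite /F ltr_pM2l// ltr_sin// in_itv/=; apply/andP; split; lra.
- by move=> x _; rewrite dF; exact: cF'.
- rewrite dF; apply/cvg_ex; exists (r * cos (- c n)).
  by apply: cvg_at_right_filter; exact: cF'.
- rewrite dF; apply/cvg_ex; exists (r * cos (c n)).
  by apply: cvg_at_left_filter; exact: cF'.
- split.
  + by move=> x _; have [h _] := has_derivZ r (has_deriv_sin x).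
  + by apply: cvg_at_right_filter; exact: cF.
  + by apply: cvg_at_left_filter; exact: cF.
- apply: continuous_in_subspaceT => x; rewrite inE => xA.
  by apply: dens_cont => //; apply: (A_sub r0 xA).
Qed.

(** Monotone convergence along the exhaustions [A r n] and [B n], whose integrals agree for each
    n. *)
Let arcsine_ge0 (r : R) (g : R -> R) : 0 < r -> continuous g -> (forall x, 0 <= g x) ->
  (\int[mu]_(x in `](- r)%R, r[) (g x / Num.sqrt (r ^+ 2 - x ^+ 2))%:E =
   \int[mu]_(th in `[(- (pi / 2))%R, (pi / 2)%R]) (g (r * sin th))%:E)%E.
Proof.
move=> r0 cg g0.
have cgs : continuous (fun th => g (r * sin th)) by cont.
have mgs D : measurable D -> measurable_fun D (fun th => (g (r * sin th))%:E).
  move=> mD; apply/measurable_EFinP; apply: measurable_funTS.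
  exact: continuous_measurable_fun.
rewrite -[RHS]integral_itv_obnd_cbnd; last exact: mgs.
rewrite -[RHS]integral_itv_bndo_bndc; last exact: mgs.
rewrite -B_cover -A_cover//.
have cA : (\int[mu]_(x in A r n) (g x / Num.sqrt (r ^+ 2 - x ^+ 2))%:E @[n --> \oo] -->
   \int[mu]_(x in \bigcup_n A r n) (g x / Num.sqrt (r ^+ 2 - x ^+ 2))%:E)%E.
  apply: ge0_nondecreasing_set_cvg_integral.
  - move=> n m nm; rewrite subsetEset => x; rewrite /A/= !in_itv/= => /andP[h1 h2].
    have h : r * sin (c n) <= r * sin (c m).
      by rewrite ler_pM2l// ler_sin'// c_le.
    by move: h1; rewrite !sinN !mulrN => h1; apply/andP; split; lra.
  - by move=> n; exact: measurable_itv.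
  - move=> n; apply: measurable_funS (dens_meas cg) => //.
    exact: A_sub.
  - by move=> n x _; rewrite lee_fin divr_ge0.
have cB : (\int[mu]_(x in B n) (g (r * sin x))%:E @[n --> \oo] -->
   \int[mu]_(x in \bigcup_n B n) (g (r * sin x))%:E)%E.
  apply: ge0_nondecreasing_set_cvg_integral.
  - move=> n m nm; rewrite subsetEset => x; rewrite /B/= !in_itv/= => /andP[h1 h2].
    by have := c_le nm => h; apply/andP; split; lra.
  - by move=> n; exact: measurable_itv.
  - by move=> n; apply: mgs; exact: measurable_itv.
  - by move=> n x _; rewrite lee_fin.
have E : (fun n => \int[mu]_(x in A r n) (g x / Num.sqrt (r ^+ 2 - x ^+ 2))%:E)%E =
         (fun n => \int[mu]_(x in B n) (g (r * sin x))%:E)%E.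
  by apply/funext => n; exact: subst_n.
by move: cA; rewrite E => cA; apply: (cvg_unique _ cA cB).
Qed.

Lemma arcsine (r : R) (f : R -> R) : 0 < r -> continuous f ->
  mu.-integrable `]- r, r[ (fun x => (f x / Num.sqrt (r ^+ 2 - x ^+ 2))%:E) /\
  (\int[mu]_(x in `]- r, r[) (f x / Num.sqrt (r ^+ 2 - x ^+ 2)) =
   \int[mu]_(th in `[- (pi / 2), pi / 2]) f (r * sin th)).
Proof.
move=> r0 cf.
have ige0 (g : R -> R) : continuous g -> (forall x, 0 <= g x) ->
    mu.-integrable `]- r, r[ (fun x => (g x / Num.sqrt (r ^+ 2 - x ^+ 2))%:E).
  move=> cg g0; apply/integrableP; split; first exact: dens_meas.
  under eq_integral do rewrite gee0_abs ?lee_fin ?divr_ge0//.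
  rewrite arcsine_ge0//.
  have cgs : continuous (fun th => g (r * sin th)) by cont.
  have /integrableP[_] := continuous_integrable_itv (- (pi / 2)) (pi / 2) cgs.
  by under eq_integral do rewrite gee0_abs ?lee_fin//.
(* Writing f = (|f| + f) - |f| reduces the signed case to two continuous nonnegative functions. *)
pose n (x : R) : R := `|f x|; pose p (x : R) : R := `|f x| + f x.
have cn : continuous n by move=> x; apply: (continuous_comp (cf x)); exact: norm_continuous.
have cp : continuous p by exact: contD.
have n0 x : 0 <= n x by rewrite /n.
have p0 x : 0 <= p x by rewrite /p -lerBlDr sub0r (le_trans (ler_norm _))// normrN.
have E x : f x / Num.sqrt (r ^+ 2 - x ^+ 2) =
    p x / Num.sqrt (r ^+ 2 - x ^+ 2) - n x / Num.sqrt (r ^+ 2 - x ^+ 2).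
  by rewrite -mulrBl /p /n addrAC subrr add0r.
have cps : continuous (fun th => p (r * sin th)) by cont.
have cns : continuous (fun th => n (r * sin th)) by cont.
split.
  have -> : (fun x => (f x / Num.sqrt (r ^+ 2 - x ^+ 2))%:E) =
      (fun x => (p x / Num.sqrt (r ^+ 2 - x ^+ 2))%:E - (n x / Num.sqrt (r ^+ 2 - x ^+ 2))%:E)%E.
    by apply/funext => x; rewrite E EFinB.
  by apply: integrableB => //; exact: ige0.
under eq_Rintegral do rewrite E.
rewrite RintegralB//; [|exact: ige0..].
rewrite {1}/Rintegral arcsine_ge0// {1}/Rintegral arcsine_ge0//.
rewrite -RintegralB//; [|exact: continuous_integrable_itv..].
by apply: eq_Rintegral => th _; rewrite /p /n addrAC subrr add0r.
Qed.

End arcsine.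

Section affine_substitution.
Context {R : realType}.
Local Notation mu := (@lebesgue_measure R).

Lemma Rint_half (g : R -> R) (p L : R) : 0 <= L -> continuous g ->
  \int[mu]_(t in `[p / 2, (p + L) / 2]) g (2 * t - p) =
  2^-1 * \int[mu]_(q in `[0, L]) g q.
Proof.
move=> L0 cg; rewrite -RintZ//.
pose F (t : R) : R := 2 * t - p.
have dF0 t : has_deriv F t 2.
  apply: has_deriv_eq; first by apply: (has_derivD (has_derivZ 2 (has_deriv_id t)) (has_deriv_cst (- p) t)).
  by rewrite mulr1 addr0.
have dF : F^`()%classic = (fun=> 2).
  by apply/funext => t; rewrite derive1E; have [_] := dF0 t.
have cF : continuous F by rewrite /F; cont.
have Fa : F (p / 2) = 0 by rewrite /F mulrC divfK ?subrr.
have Fb : F ((p + L) / 2) = L by rewrite /F mulrC divfK// addrC addKr.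
have cG : continuous (fun q => 2^-1 * g q) by cont.
transitivity (\int[mu]_(q in `[F (p / 2), F ((p + L) / 2)]) (2^-1 * g q)); last first.
  by rewrite Fa Fb.
rewrite /Rintegral (@integration_by_substitution_increasing R F (fun q => 2^-1 * g q)).
- congr fine; apply: eq_integral => t _; congr EFin; rewrite dF.
  change (g (2 * t - p) = 2^-1 * g (2 * t - p) * 2).
  by field.
- by rewrite ler_pM2r ?invr_gt0// lerDl.
- by move=> x y _ _ xy; rewrite /F; lra.
- by move=> x _; rewrite dF; exact: cvg_cst.
- by rewrite dF; apply/cvg_ex; exists 2; exact: cvg_cst.
- by rewrite dF; apply/cvg_ex; exists 2; exact: cvg_cst.
- split.
  + by move=> x _; have [h _] := dF0 x.
  + by apply: cvg_at_right_filter; exact: cF.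
  + by apply: cvg_at_left_filter; exact: cF.
- exact: continuous_subspaceT.
Qed.

Lemma Rint_reflect (g : R -> R) (y L : R) : 0 <= L -> continuous g ->
  \int[mu]_(x in `[y - L, y]) g (y - x) = \int[mu]_(p in `[0, L]) g p.
Proof.
move=> L0 cg.
pose F (x : R) : R := y - x.
have dF0 t : has_deriv F t (-1).
  apply: has_deriv_eq; first by apply: (has_derivD (has_deriv_cst y t) (has_derivN (has_deriv_id t))).
  by rewrite add0r.
have dF : F^`()%classic = (fun=> -1).
  by apply/funext => t; rewrite derive1E; have [_] := dF0 t.
have cF : continuous F by rewrite /F; cont.
have Fa : F (y - L) = L by rewrite /F opprB addrC subrK.
have Fb : F y = 0 by rewrite /F subrr.
transitivity (\int[mu]_(p in `[F y, F (y - L)]) g p); last by rewrite Fa Fb.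
rewrite /Rintegral (@integration_by_substitution_decreasing R F g).
- congr fine; apply: eq_integral => t _; congr EFin; rewrite dF.
  change (g (y - t) = g (y - t) * - -1).
  by rewrite opprK mulr1.
- by rewrite gerBl.
- by move=> x z _ _ xy; rewrite /F; lra.
- by move=> x _; rewrite dF; exact: cvg_cst.
- by rewrite dF; apply/cvg_ex; exists (-1); exact: cvg_cst.
- by rewrite dF; apply/cvg_ex; exists (-1); exact: cvg_cst.
- split.
  + by move=> x _; have [h _] := dF0 x.
  + by apply: cvg_at_right_filter; exact: cF.
  + by apply: cvg_at_left_filter; exact: cF.
- exact: continuous_subspaceT.
Qed.

End affine_substitution.

(** * Gamma on lines parallel to the x2 axis *)

Section gamma_slices.
Context {R : realType}.
Local Notation mu := (@lebesgue_measure R).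
Variables (y1 t x1 : R).
Let p := y1 - x1.
Let q := 2 * t - p.
Let r := Num.sqrt (zf y1 p q).

Let discrE (x2 : R) : (y1 ^+ 3 - x1 ^+ 3) * (2 * t + x1 - y1) - 3 * x2 ^+ 2 =
  3 * (zf y1 p q - x2 ^+ 2).
Proof. by rewrite /zf /q /p; field. Qed.

Lemma Gamma_inside x2 : 0 < p -> 0 < q ->
  Gamma t x1 y1 x2 = ((fun x => (2 * pi)^-1 * (1 / Num.sqrt (r ^+ 2 - x ^+ 2))) \_ `]- r, r[) x2.
Proof.
move=> p0 q0; have z0 := zf_gt0 y1 p0 q0.
have t0 : 0 < t by move: q0; rewrite /q; lra.
have xy : x1 < y1 by move: p0; rewrite subr_gt0.
have r2 : r ^+ 2 = zf y1 p q by rewrite sqr_sqrtr// ltW.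
have r0 : 0 < r by rewrite sqrtr_gt0.
rewrite /Gamma discrE t0 xy /= pmulr_rgt0// -r2 subr_gt0 patchE.
have -> : (x2 ^+ 2 < r ^+ 2) = (x2 \in `]- r, r[%classic).
  rewrite mem_setE in_itv/= -ltr_norml.
  by rewrite -(@ltr_pXn2r _ 2 _ `|x2| r) ?nnegrE ?(ltW r0)// real_normK ?num_real.
case: ifP => // _.
(* The sqrt 3 in [Gamma] cancels the one from the radicand 3 (z - x2^2), leaving the constant 1/(2
   pi). *)
have s3 : Num.sqrt 3 != 0 :> R by rewrite gt_eqF// sqrtr_gt0.
by rewrite sqrtrM// !mul1r [X in _ * X = _]invfM mulrACA mulfV// mul1r.
Qed.

(** If q <= 0 < p, then z, being linear in q, is nonpositive, so the radicand cannot be positive. *)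
Lemma Gamma_outside x2 : ~~ ((0 < p) && (0 < q)) -> Gamma t x1 y1 x2 = 0.
Proof.
rewrite negb_and -!leNgt /Gamma discrE => /orP[p0|q0].
  by rewrite (_ : x1 < y1 = false) ?andbF//; apply/negbTE; rewrite -leNgt -subr_le0.
case: ifPn => // /and3P[_ xy]; rewrite pmulr_rgt0// subr_gt0 => h.
have p0 : 0 < p by rewrite subr_gt0.
have := zf_ge0 y1 (ltW p0) (_ : 0 <= - q); rewrite oppr_ge0 => /(_ q0).
rewrite /zf mulNr oppr_ge0 -/(zf y1 p q) => z0.
by have := le_lt_trans (sqr_ge0 x2) h; rewrite ltNge z0.
Qed.

Lemma Gamma_slice (f : R -> R) : 0 < p -> 0 < q -> continuous f ->
  mu.-integrable setT (fun x2 => (Gamma t x1 y1 x2 * f x2)%:E) /\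
  \int[mu]_x2 (Gamma t x1 y1 x2 * f x2) =
  (2 * pi)^-1 * \int[mu]_(th in `[- (pi / 2), pi / 2]) f (r * sin th).
Proof.
move=> p0 q0 cf; have r0 : 0 < r by rewrite sqrtr_gt0 zf_gt0.
have [i1 i2] := arcsine r0 cf.
have E : (fun x2 => Gamma t x1 y1 x2 * f x2) =
    (fun x => (2 * pi)^-1 * (f x / Num.sqrt (r ^+ 2 - x ^+ 2))) \_ `]- r, r[.
  apply/funext => x; rewrite Gamma_inside// !patchE; case: ifP => _; last by rewrite mul0r.
  by rewrite mul1r -mulrA; congr (_ * _); rewrite mulrC.
have i3 : mu.-integrable `]- r, r[
    (fun x => ((2 * pi)^-1 * (f x / Num.sqrt (r ^+ 2 - x ^+ 2)))%:E).
  rewrite (_ : (fun _ => _) =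
    (fun x => ((2 * pi)^-1)%:E * (f x / Num.sqrt (r ^+ 2 - x ^+ 2))%:E)%E); first exact: integrableZl.
  by apply/funext => x; rewrite EFinM.
split.
  have -> : (fun x2 => (Gamma t x1 y1 x2 * f x2)%:E) =
     ((EFin \o (fun x => (2 * pi)^-1 * (f x / Num.sqrt (r ^+ 2 - x ^+ 2)))) \_ `]- r, r[).
    by rewrite restrict_EFin -E.
  have mi : measurable (`]- r, r[%classic : set (measurableTypeR R)) by exact: measurable_itv.
  have /iffLR h := @integrable_mkcond _ _ _ mu `]- r, r[%classic
    (EFin \o (fun x => (2 * pi)^-1 * (f x / Num.sqrt (r ^+ 2 - x ^+ 2)))) mi.
  exact: h i3.
have -> : (fun x2 => Gamma t x1 y1 x2 * f x2) = _ := E.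
by rewrite -Rintegral_mkcond RintegralZl// i2.
Qed.

Lemma Gamma_ge0 x2 : 0 <= Gamma t x1 y1 x2.
Proof.
rewrite /Gamma; case: ifP => // _.
by rewrite !mulr_ge0// ?invr_ge0 ?mulr_ge0 ?pi_ge0// ?invr_ge0.
Qed.

(** A nonzero slice has mass (2 pi)^-1 pi = 1/2, independently of t and x1; this uniform bound is
    what yields local integrability. *)
Lemma Gamma_slice_le : (\int[mu]_x2 (Gamma t x1 y1 x2)%:E <= (2^-1)%:E)%E.
Proof.
have [/andP[p0 q0]|pq] := boolP ((0 < p) && (0 < q)); last first.
  under eq_integral do rewrite Gamma_outside//.
  by rewrite integral0 lee_fin invr_ge0.
have [i1 i2] := Gamma_slice p0 q0 (@cont_cst _ _ (1 : R)).
move: i2; rewrite Rintegral_cst// mul1r.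
have -> : (fine (mu `[- (pi / 2), pi / 2]) = pi).
  have := @circ0 R (fun=> 1) 0 0 0; rewrite circE.
  under eq_Rintegral do rewrite expr0 mul1r.
  by rewrite Rintegral_cst// mul1r mulr1.
move=> i2.
have E : (fun x2 => (Gamma t x1 y1 x2 * 1)%:E) = (fun x2 => (Gamma t x1 y1 x2)%:E).
  by apply/funext => x; rewrite mulr1.
have := integrable_fin_num _ i1; rewrite E => /(_ measurableT) fn.
rewrite -(fineK fn) lee_fin.
move: i2; rewrite /Rintegral; under eq_integral do rewrite mulr1.
move=> ->; have p0' : pi != 0 :> R by rewrite gt_eqF// pi_gt0.
by rewrite invfM -mulrA mulVf// mulr1.
Qed.

End gamma_slices.

Section compact_sets.
Context {R : realType}.

Lemma compact_box (K : set (space3 R)) : compact K ->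
  exists2 B : R, 0 < B & forall z, K z -> [/\ `|z.1.1| <= B, `|z.1.2| <= B & `|z.2| <= B].
Proof.
move=> /compact_bounded [M [_ HM]]; exists (`|M| + 1); first by rewrite ltr_pwDr.
move=> z Kz; have : `|z| <= `|M| + 1.
  by apply: HM => //; rewrite (le_lt_trans (ler_norm M))// ltrDl.
by rewrite !prod_normE !ge_max => /andP[/andP[h1 h2] h3]; split.
Qed.

Lemma supp_eq0 (f : space3 R -> R) z : ~ supp f z -> f z = 0.
Proof.
by move=> nz; apply/eqP; apply: contrapT => fz; apply: nz; apply: subset_closure; exact/negP.
Qed.

Lemma supp_vanish (f : space3 R -> R) : compact (supp f) ->
  exists2 T : R, 0 < T & vanish_after T f.
Proof.
move=> /compact_box[B B0 hB]; exists B => // z Bz; apply: supp_eq0 => /hB[h _ _].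
by move: (lt_le_trans Bz (le_trans (ler_norm _) h)); rewrite ltxx.
Qed.

End compact_sets.

(* The library attaches the sigma-finite structure of a product measure to
   pairs of subprobabilities only, so it is restored here under a new name. *)
Section sigma_finite_product.
Context d1 d2 (T1 : measurableType d1) (T2 : measurableType d2) (R : realType).
Variables (m1 : {sigma_finite_measure set T1 -> \bar R}).
Variables (m2 : {sigma_finite_measure set T2 -> \bar R}).

Definition prodm : set (T1 * T2)%type -> \bar R := (m1 \x m2)%E.
HB.instance Definition _ := Measure.on prodm.

Let prodm_sigma_finite : sigma_finite setT prodm.
Proof.
have /sigma_finiteP[F [TF ndF Foo]] := sigma_finiteT m1.
have /sigma_finiteP[G [TG ndG Goo]] := sigma_finiteT m2.
exists (fun n => F n `*` G n) => [|n].
  apply/esym/seteqP; split => // -[x y] _.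
  have [[i _ Fi] [j _ Gj]] : (\bigcup_i F i) x /\ (\bigcup_i G i) y by rewrite -TF -TG.
  exists (maxn i j) => //; split => /=.
    by move: x Fi; apply/subsetPset/ndF/leq_maxl.
  by move: y Gj; apply/subsetPset/ndG/leq_maxr.
have [mF ?] := Foo n; have [mG ?] := Goo n.
split; first exact: measurableX.
by rewrite /prodm product_measure1E// lte_mul_pinfty// ge0_fin_numE.
Qed.

HB.instance Definition _ := Measure_isSigmaFinite.Build _ _ _ prodm prodm_sigma_finite.

End sigma_finite_product.

Section triple_product.
Context (d1 d2 d3 : measure_display) (T1 : measurableType d1).
Context (T2 : measurableType d2) (T3 : measurableType d3) (R : realType).
Variables (m1 : {sigma_finite_measure set T1 -> \bar R}).
Variables (m2 : {sigma_finite_measure set T2 -> \bar R}).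
Variables (m3 : {sigma_finite_measure set T3 -> \bar R}).
Variable (f : (T1 * T2 * T3)%type -> \bar R).

Lemma tonelli_prod3 : measurable_fun setT f -> (forall z, 0 <= f z)%E ->
  (\int[(m1 \x m2) \x m3]_z f z = \int[m1 \x m2]_w \int[m3]_x f (w, x))%E.
Proof. by move=> mf f0; apply: (@fubini_tonelli1 _ _ _ _ R (prodm m1 m2) m3). Qed.

Hypothesis intf : ((m1 \x m2) \x m3)%E.-integrable setT f.

Lemma fubini_prod3 :
  (\int[(m1 \x m2) \x m3]_z f z = \int[m1 \x m2]_w \int[m3]_x f (w, x))%E.
Proof. by apply/esym; apply: (@integral12_prod_meas1 _ _ _ _ R (prodm m1 m2) m3). Qed.

Lemma fubini_prod3_integrable : (m1 \x m2)%E.-integrable setT (fun w => \int[m3]_x f (w, x))%E.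
Proof. by apply: (@integrable_fubini_F _ _ _ _ R (prodm m1 m2) m3). Qed.

End triple_product.

(** * Gamma as a functional: local integrability and agreement with psi *)

Section fundamental_integral.
Context {R : realType}.
Local Notation mu := (@lebesgue_measure R).
Local Notation mu2 := ((@lebesgue_measure R \x @lebesgue_measure R)%E).
Let M1 := measurableTypeR R.
Let M2 := (M1 * M1)%type.
Let M3 := (M1 * M1 * M1)%type.
Variable y1 : R.
Implicit Type f : space3 R -> R.

Lemma tonelli3 (f : M3 -> \bar R) : measurable_fun setT f -> (forall z, 0 <= f z)%E ->
  (\int[@lebesgue3 R]_z f z = \int[mu2]_w \int[mu]_x f (w, x))%E.
Proof. by move=> mf f0; rewrite (@tonelli_prod3 _ _ _ _ _ _ R mu mu mu). Qed.

Lemma fubini3 (f : M3 -> \bar R) : (@lebesgue3 R).-integrable setT f ->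
  (\int[@lebesgue3 R]_z f z = \int[mu2]_w \int[mu]_x f (w, x))%E.
Proof. by move=> intf; rewrite (@fubini_prod3 _ _ _ _ _ _ R mu mu mu). Qed.

Lemma fubini3_integrable (f : M3 -> \bar R) : (@lebesgue3 R).-integrable setT f ->
  mu2.-integrable setT (fun w => \int[mu]_x f (w, x))%E.
Proof. by move=> intf; apply: (@fubini_prod3_integrable _ _ _ _ _ _ R mu mu mu). Qed.

Lemma GammaF_ge0 z : 0 <= GammaF y1 z.
Proof. exact: Gamma_ge0. Qed.

Lemma GammaF_locally_integrable : locally_integrable3 (GammaF y1).
Proof.
split; first exact: measurable_GammaF.
move=> K cK; have [B B0 hB] := compact_box cK.
(* Only t and x1 are confined to a bounded set; x2 stays free, so that whole slices of mass at most
   1/2 are integrated over a square of finite area. *)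
pose D2 : set M2 := `[- B, B]%classic `*` `[- B, B]%classic.
pose D3 : set M3 := D2 `*` setT.
have mD2 : measurable D2 by apply: measurableX; exact: measurable_itv.
have mD3 : measurable D3 by apply: measurableX.
have mG : measurable_fun setT (fun z : M3 => (GammaF y1 z)%:E).
  by apply/measurable_EFinP; exact: measurable_GammaF.
under eq_integral do rewrite ger0_norm ?GammaF_ge0//.
apply: (@le_lt_trans _ _ (\int[@lebesgue3 R]_(z in D3) (GammaF y1 z)%:E)%E).
  apply: ge0_subset_integral => //.
  - exact: measurable_compact3.
  - exact: measurable_funTS.
  - by move=> z _; rewrite lee_fin GammaF_ge0.
  - by move=> z /hB[h1 h2 _]; split => //; split => /=; rewrite in_itv/= -ler_norml.
rewrite integral_mkcond tonelli3; last 2 first.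
- by apply/(measurable_restrictT _ mD3); exact: measurable_funTS.
- by move=> z; rewrite patchE; case: ifP => // _; rewrite lee_fin GammaF_ge0.
apply: (@le_lt_trans _ _ (\int[mu2]_(w in D2) (2^-1)%:E)%E); last first.
  rewrite integral_cst// [X in (_ * X)%E](_ : _ = mu `[(- B)%R, B] * mu `[(- B)%R, B])%E; last first.
    have mi : measurable (`[- B, B]%classic : set M1) by exact: measurable_itv.
    exact: (product_measure1E mu mu mi mi).
  by rewrite !lebesgue_measure_itv/= lte_fin; case: ifP => _; rewrite -?EFinB -?EFinM ?mul0e ?mule0 ltry.
rewrite [leRHS]integral_mkcond; apply: ge0_le_integral => //.
- by move=> w _; apply: integral_ge0 => x _; rewrite patchE; case: ifP => // _; rewrite lee_fin GammaF_ge0.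
- apply: (@measurable_fun_fubini_tonelli_F _ _ _ _ _ mu).
  + by apply/(measurable_restrictT _ mD3); exact: measurable_funTS.
  + by move=> z; rewrite patchE; case: ifP => // _; rewrite lee_fin GammaF_ge0.
- by apply/(measurable_restrictT _ mD2); exact: measurable_cst.
move=> [t x1] _; rewrite patchE.
case: ifPn => [tx|tx].
  apply: le_trans (Gamma_slice_le y1 t x1).
  apply: ge0_le_integral => //.
  - by move=> x _; rewrite patchE; case: ifP => // _; rewrite lee_fin GammaF_ge0.
  - have mr : measurable_fun setT ((fun z : M3 => (GammaF y1 z)%:E) \_ D3).
      by apply/(measurable_restrictT _ mD3); exact: measurable_funTS.
    exact: (measurableT_comp mr (measurable_pair1 (t, x1))).
  - exact: (measurableT_comp mG (measurable_pair1 ((t, x1) : M2))).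
  - move=> x _; rewrite patchE; case: ifP => // _.
    by rewrite lee_fin Gamma_ge0.
rewrite integral0_eq//= => x _; rewrite patchE ifF//; apply/negbTE.
by apply: contra tx; rewrite !inE => -[].
Qed.

Lemma GammaF_mul_integrable f : continuous f -> compact (supp f) ->
  (@lebesgue3 R).-integrable setT (fun z : M3 => (GammaF y1 z * f z)%:E).
Proof.
move=> cf cK; have mK := measurable_compact3 cK.
have [mG iG] := GammaF_locally_integrable.
have iK : (@lebesgue3 R).-integrable (supp f : set M3) (fun z : M3 => (GammaF y1 z)%:E).
  apply/integrableP; split; last exact: iG.
  by apply: measurable_funTS; apply/measurable_EFinP.
have : (@lebesgue3 R).-integrable (supp f : set M3)
    ((fun z : M3 => (GammaF y1 z)%:E) \* (EFin \o f))%E.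
  apply: integrableMl => //.
    by apply: measurable_funTS; exact: continuous_measurable3.
  have /compact_bounded[M [Mr HM]] : compact (f @` supp f).
    by apply: continuous_compact => //; exact: continuous_subspaceT.
  exists M; split => // N MN z Kz; apply: (HM N MN); by exists z.
move=> /(iffLR (integrable_mkcond _ mK)); congr (integrable _ _ _).
apply/funext => z; rewrite patchE /=; case: ifPn => [_|]; first by rewrite EFinM.
by rewrite notin_setE => /supp_eq0 ->; rewrite mulr0.
Qed.

(** With the kernel based at (0, y1, 0), the relations t = (p + q)/2 and x1 = y1 - p put its values
    of [f] on the line over (t, x1). *)
Definition slice_mean f (w : M2) : R :=
  let p := y1 - w.2 in let q := 2 * w.1 - p in
  if (0 < p) && (0 < q) then (2 * pi)^-1 * Ker 0 f 0 y1 0 p q else 0.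

Lemma slice_meanE f w : continuous f ->
  (\int[mu]_x2 (GammaF y1 (w, x2) * f (w, x2))%:E = (slice_mean f w)%:E)%E.
Proof.
case: w => t x1 cf; rewrite /slice_mean /=.
case: ifPn => [/andP[p0 q0]|pq]; last first.
  by rewrite integral0_eq// => x _; rewrite /GammaF /= Gamma_outside// mul0r.
have cs : continuous (fun x => f ((t, x1), x)) by cont.
have [i1 i2] := Gamma_slice p0 q0 cs.
rewrite -[LHS]fineK; last exact: integrable_fin_num.
congr EFin; rewrite [LHS]i2 /Ker circE; congr (_ * _).
apply: eq_Rintegral => th _; rewrite expr0 mul1r; congr (f (_, _, _)); last by rewrite add0r.
  by field.
by rewrite subKr.
Qed.

Lemma slice_mean_int_t f (T L x1 : R) : continuous f -> vanish_after T f ->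
  T < L / 2 -> 0 <= L ->
  (\int[mu]_t (slice_mean f (t, x1))%:E =
  (if 0 < y1 - x1 then (4 * pi)^-1 * \int[mu]_(q in `[0%R, L]) Ker 0 f 0 y1 0 (y1 - x1) q
  else 0)%R%:E)%E.
Proof.
move=> cf vf TL L0; rewrite /slice_mean /=.
case: ifPn => p0 /=; last by rewrite integral0.
set p := y1 - x1 in p0 *.
have cK : continuous (fun q : R => Ker 0 f 0 y1 0 p q) by contK.
have cK2 : continuous (fun t : R => (2 * pi)^-1 * Ker 0 f 0 y1 0 p (2 * t - p)) by contK.
(* The left end is open because q > 0 is strict. To the right of the interval t exceeds L/2, hence
   T, and the kernel vanishes. *)
have E : (fun t : R => if 0 < 2 * t - p then (2 * pi)^-1 * Ker 0 f 0 y1 0 p (2 * t - p) else 0) =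
   (fun t : R => (2 * pi)^-1 * Ker 0 f 0 y1 0 p (2 * t - p)) \_ `]p / 2, (p + L) / 2].
  apply/funext => t; rewrite patchE mem_setE in_itv/=.
  have -> : (0 < 2 * t - p) = (p / 2 < t).
    by rewrite subr_gt0 ltr_pdivrMr// mulrC.
  case: ifP => //= pt; case: ifPn => //; rewrite -ltNge => tL.
  rewrite (@Ker_vanish _ T) ?mulr0//; apply: (lt_trans TL).
  by move: tL p0; lra.
have iK : mu.-integrable `]p / 2, (p + L) / 2]
    (EFin \o (fun t : R => (2 * pi)^-1 * Ker 0 f 0 y1 0 p (2 * t - p))).
  have := continuous_integrable_itv (p / 2) ((p + L) / 2) cK2.
  by apply: integrableS => //; exact: subset_itv_oc_cc.
have iK' : mu.-integrable setT (EFin \o (fun t : R =>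
    if 0 < 2 * t - p then (2 * pi)^-1 * Ker 0 f 0 y1 0 p (2 * t - p) else 0)).
  rewrite E -restrict_EFin.
  have mi : measurable (`]p / 2, (p + L) / 2]%classic : set (measurableTypeR R)).
    exact: measurable_itv.
  by have /iffLR h := @integrable_mkcond _ _ _ mu _
    (EFin \o (fun t : R => (2 * pi)^-1 * Ker 0 f 0 y1 0 p (2 * t - p))) mi; exact: h iK.
rewrite -[LHS]fineK; last exact: (integrable_fin_num _ iK').
congr EFin; change (\int[mu]_t (fun t : R =>
    if 0 < 2 * t - p then (2 * pi)^-1 * Ker 0 f 0 y1 0 p (2 * t - p) else 0) t =
  (4 * pi)^-1 * \int[mu]_(q in `[0, L]) Ker 0 f 0 y1 0 p q).
rewrite E -Rintegral_mkcond Rintegral_itv_obnd_cbnd//.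
rewrite (@Rint_half _ (fun q => (2 * pi)^-1 * Ker 0 f 0 y1 0 p q))//; last by contK.
rewrite RintZ// mulrA; congr (_ * _).
by rewrite -invfM mulrA -natrM.
Qed.

(** Integration goes over x2, then t at fixed x1, then x1. At fixed p the change from t to q has dt
    = dq/2, which turns 1/(2 pi) into 1/(4 pi). *)
Lemma regular_distribution_psi f (T L : R) : continuous f -> compact (supp f) ->
  vanish_after T f -> T < L / 2 -> 0 <= L ->
  regular_distribution (GammaF y1) f = psi L f (0, y1, 0).
Proof.
move=> cf cK vf TL L0; rewrite /regular_distribution.
have iG := GammaF_mul_integrable cf cK.
have FE : (fun w => \int[mu]_x (GammaF y1 (w, x) * f (w, x))%:E)%E = EFin \o slice_mean f.
  by apply/funext => w; rewrite slice_meanE.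
have := fubini3_integrable iG; rewrite FE => iF.
rewrite /Rintegral (fubini3 iG) FE.
rewrite -(@integral21_prod_meas1 _ _ _ _ _ mu mu _ iF).
pose A (p : R) := (4 * pi)^-1 * \int[mu]_(q in `[0, L]) Ker 0 f 0 y1 0 p q.
have GE x1 : (\int[mu]_t (slice_mean f (t, x1))%:E =
    (((fun x1 => A (y1 - x1)) \_ `[(y1 - L)%R, y1[) x1)%:E)%E.
  rewrite (slice_mean_int_t x1 cf vf TL L0) patchE mem_setE in_itv/= subr_gt0 andbC.
  congr EFin; case: ifP => //= xy; case: ifPn => //; rewrite -ltNge => xL.
  rewrite (@eq_Rintegral _ _ _ _ _ (fun=> 0)) ?Rintegral_cst ?mul0r ?mulr0//.
  move=> q; rewrite inE/= in_itv/= => /andP[q0 _].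
  by apply: (@Ker_vanish _ T) => //; apply: (lt_trans TL); move: q0 xL; lra.
have cA : continuous A.
  apply: contM; first exact: cont_cst.
  apply: (@continuous_Rint_snd _ L (fun p q => Ker 0 f 0 y1 0 p q)); contK.
have cA2 : continuous (fun x1 => A (y1 - x1)) by cont.
transitivity (\int[mu]_x1 ((fun x1 => A (y1 - x1)) \_ `[y1 - L, y1[) x1).
  by rewrite /Rintegral; congr fine; apply: eq_integral => x1 _; rewrite -GE.
rewrite -Rintegral_mkcond Rintegral_itv_bndo_bndc; last first.
  have := continuous_integrable_itv (y1 - L) y1 cA2.
  by apply: integrableS => //; exact: subset_itv_co_cc.
rewrite (@Rint_reflect _ A)// /psi J000E /A RintZ//.
by apply: (@continuous_Rint_snd _ L (fun p q => Ker 0 f 0 y1 0 p q)); contK.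
Qed.

End fundamental_integral.

(** * Test functions, existence and uniqueness *)

Section test_functions.
Context {R : realType}.
Implicit Types (f g : space3 R -> R) (c : coordinate).

Lemma pd_near_eq c f g (z : space3 R) : (\forall w \near z, f w = g w) ->
  \forall w \near z, pd c f w = pd c g w.
Proof.
move=> /near_join; apply: filterS => w fg; rewrite !pdE /partial_deriv.
exact: near_eq_derive.
Qed.

Lemma supp_closed_sub f (K : set (space3 R)) : closed K ->
  (forall z, ~ K z -> f z = 0) -> supp f `<=` K.
Proof.
move=> cK h; rewrite (closure_id K).1//; apply: closure_subset => z fz.
by apply: contrapT => /h fz0; move: fz; rewrite /= fz0 eqxx.
Qed.

Lemma compact_supp_sub f (K : set (space3 R)) : compact K ->
  (forall z, ~ K z -> f z = 0) -> compact (supp f).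
Proof.
move=> cK h; apply: (subclosed_compact _ cK); first exact: closed_closure.
by apply: supp_closed_sub => //; apply: compact_closed => //; exact: norm_hausdorff.
Qed.

Lemma test_pd c f : test_function f -> test_function (pd c f).
Proof.
move=> [sf cf]; split; first exact: smooth_pd.
apply: compact_supp_sub cf _ => z nz.
have : \forall w \near z, f w = (fun=> 0) w.
  have : nbhs z (~` supp f).
    by apply: open_nbhs_nbhs; split => //; apply: closed_openC; exact: closed_closure.
  by apply: filterS => w; exact: supp_eq0.
by move=> /(pd_near_eq c)/nbhs_singleton ->; rewrite pd_cst.
Qed.

Lemma test_mul f g : smooth g -> test_function f -> test_function (fun z => g z * f z).
Proof.
move=> sg [sf cf]; split; first exact: (smoothM sg sf).
by apply: compact_supp_sub cf _ => z /supp_eq0 ->; rewrite mulr0.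
Qed.

Lemma test_lin (a : R) f g : test_function f -> test_function g ->
  test_function (fun z => a * f z + g z).
Proof.
move=> [sf cf] [sg cg]; split; first exact: (smoothD (smoothM (smooth_cst a) sf) sg).
apply: (@compact_supp_sub _ (supp f `|` supp g)); first exact: compactU.
by move=> z /not_orP[/supp_eq0 -> /supp_eq0 ->]; rewrite mulr0 addr0.
Qed.

Lemma wave_lin f : wave f = (fun z => (-2) * pd Cx1 (pd Ct f) z +
  ((-1) * (z.1.2 ^+ 2 * pd Cx2 (pd Cx2 f) z) + pd Ct (pd Ct f) z)).
Proof. by apply/funext => z; rewrite /wave; ring. Qed.

Lemma smooth_x1sqr : smooth (fun z : space3 R => z.1.2 ^+ 2).
Proof. exact: (smoothM (@smooth_x1 R) (@smooth_x1 R)). Qed.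

Lemma test_wave f : test_function f -> test_function (wave f).
Proof.
move=> tf; rewrite wave_lin.
apply: (test_lin (-2) (test_pd Cx1 (test_pd Ct tf))).
apply: (test_lin (-1)); last by do 2 apply: test_pd.
exact: (test_mul smooth_x1sqr (test_pd Cx2 (test_pd Cx2 tf))).
Qed.

Lemma wave_near_eq f g (z : space3 R) : (\forall w \near z, f w = g w) -> wave f z = wave g z.
Proof.
move=> fg; rewrite /wave.
have h a b := nbhs_singleton (pd_near_eq a (pd_near_eq b fg)).
by rewrite !h.
Qed.

Lemma pd_x1sqr_mul f : smooth f ->
  pd Cx2 (fun z => z.1.2 ^+ 2 * f z) = (fun z => z.1.2 ^+ 2 * pd Cx2 f z).
Proof.
move=> sf; rewrite (pdM _ smooth_x1sqr sf); apply/funext => z.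
rewrite (_ : pd Cx2 (fun z : space3 R => z.1.2 ^+ 2) z = 0) ?mulr0 ?addr0//.
by apply: pd_eq => /=; exact: has_deriv_cst.
Qed.

(* The operator is formally self-adjoint: its only variable coefficient does not
   depend on x2. *)
Lemma wave_op_adjoint (E : (space3 R -> R) -> R) f : is_distribution E ->
  test_function f -> wave_op E f = E (wave f).
Proof.
move=> [linE _] tf; have [sf _] := tf.
have t00 := test_pd Ct (test_pd Ct tf); have t10 := test_pd Cx1 (test_pd Ct tf).
have t22 := test_mul smooth_x1sqr (test_pd Cx2 (test_pd Cx2 tf)).
rewrite wave_lin linE//; last exact: (test_lin (-1) t22 t00).
rewrite (linE (-1) _ _ t22 t00) /wave_op /dist_mul /dist_partial -!pdE.
rewrite pd_x1sqr_mul// pd_x1sqr_mul; last exact: smooth_pd.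
by ring.
Qed.

End test_functions.

(** * A smooth cutoff in time *)

Section cutoff.
Context {R : realType}.
Local Notation mu := (@lebesgue_measure R).
Implicit Types (f : space3 R -> R).

(* A cutoff in time is obtained from the restriction of a given test function to
   a line parallel to the t axis, so that no explicit bump function is needed. *)
Definition time_mean (L k d a b : R) f (z : space3 R) : R :=
  \int[mu]_(s in `[0, L]) f (k * (z.1.1 - s) + d, a, b).

Lemma smooth_time_mean L k d a b f : smooth f -> smooth (time_mean L k d a b f).
Proof.
move=> sf; apply: Cn_smooth => n; elim: n f sf => [|n IH] f sf.
  have cf := smooth_continuous sf.
  by apply: (@continuous_Rintegral _ _ (fun w : space3 R * R => f (k * (w.1.1.1 - w.2) + d, a, b))); cont.
have cf := smooth_continuous sf.
have cf' := smooth_continuous (smooth_pd Ct sf).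
apply: (@Cn_intro _ _ _ (fun c => if c is Ct
    then fun z => k * time_mean L k d a b (pd Ct f) z else fun=> 0)).
- by apply: (@continuous_Rintegral _ _ (fun w : space3 R * R => f (k * (w.1.1.1 - w.2) + d, a, b))); cont.
- case=> -[[t y] x]; rewrite /time_mean /=; [|exact: has_deriv_cst..].
  apply: has_deriv_eq.
    apply: (@has_deriv_Rintegral _ (fun u s => f (k * (u - s) + d, a, b))
      (fun u s => k * pd Ct f (k * (u - s) + d, a, b))); [by cont|by cont|].
    apply: near_all => u s _; apply: has_deriv_eq.
      apply: (@has_deriv_comp R (fun v => f (v, a, b)) (fun u => k * (u - s) + d)).
        exact: smooth_dert.
      apply: has_derivD; last exact: has_deriv_cst.
      by apply: has_derivZ; apply: has_derivD; [exact: has_deriv_id|exact: has_deriv_cst].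
    by rewrite !addr0 mulr1 mulrC.
  by rewrite RintZ//; cont.
- case; [|exact: Cn_cst..].
  by apply: CnM; [exact: Cn_cst|apply: IH; exact: smooth_pd].
Qed.

Lemma Rint_pos (g : R -> R) (a b s0 : R) : continuous g -> (forall s, 0 <= g s) ->
  a < s0 < b -> 0 < g s0 -> 0 < \int[mu]_(s in `[a, b]) g s.
Proof.
move=> cg g0 /andP[as0 sb] gs0.
have /cvgrPdist_lt/(_ _ (divr_gt0 gs0 (ltr0n R 2)))[e /= e0 he] := cg s0.
pose d := Num.min (e / 2) (Num.min (s0 - a) (b - s0)).
have d0 : 0 < d by rewrite !lt_min divr_gt0//= !subr_gt0 as0.
have [de [da db]] : d <= e / 2 /\ d <= s0 - a /\ d <= b - s0.
  by rewrite /d; split; [|split]; rewrite !ge_min lexx ?orbT.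
have gd s : s \in `[s0 - d, s0 + d] -> g s0 / 2 <= g s.
  rewrite in_itv/= => /andP[h1 h2]; have : `|g s0 - g s| < g s0 / 2.
    by apply: he => /=; rewrite ltr_norml; apply/andP; split; lra.
  by rewrite ltr_norml => /andP[_ h]; lra.
have i1 : mu.-integrable `[a, b] (EFin \o g) by exact: continuous_integrable_itv.
have fin : (\int[mu]_(s in `[a, b]) (g s)%:E)%E \is a fin_num.
  by apply: (integrable_fin_num _ i1).
apply: (@lt_le_trans _ _ (g s0 / 2 * (2 * d))).
  by rewrite !mulr_gt0// invr_gt0.
rewrite -lee_fin /Rintegral fineK//.
have mg D : measurable D -> measurable_fun D (fun s => (g s)%:E).
  move=> mD; apply/measurable_EFinP; apply: measurable_funTS.
  exact: continuous_measurable_fun.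
apply: (@le_trans _ _ (\int[mu]_(s in `[(s0 - d)%R, (s0 + d)%R]) (g s)%:E)%E); last first.
  apply: ge0_subset_integral => //.
  - exact: mg.
  - by move=> s _; rewrite lee_fin.
  - by move=> s /=; rewrite !in_itv/= => /andP[h1 h2]; apply/andP; split; lra.
apply: (@le_trans _ _ (\int[mu]_(s in `[(s0 - d)%R, (s0 + d)%R]) (g s0 / 2)%:E)%E).
  have md : mu `[(s0 - d)%R, (s0 + d)%R] = (2 * d)%:E.
    rewrite lebesgue_measure_itv/= lte_fin ifT; last by lra.
    by rewrite -EFinB; congr EFin; ring.
  rewrite integral_cst// [X in (_ * X)%E](_ : _ = (2 * d)%:E)//.
apply: ge0_le_integral => //.
- by move=> s _; rewrite lee_fin divr_ge0.
- exact: mg.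
Qed.

Lemma Rint_support (g : R -> R) (a b u v : R) : a <= u -> v <= b ->
  (forall s, s \notin `[u, v] -> g s = 0) ->
  \int[mu]_(s in `[a, b]) g s = \int[mu]_(s in `[u, v]) g s.
Proof.
move=> au vb h; rewrite Rintegral_mkcond [RHS]Rintegral_mkcond.
apply: eq_Rintegral => s _; rewrite !patchE !mem_setE.
have [suv|/h ->] := boolP (s \in `[u, v]); last by rewrite !if_same.
rewrite ifT//; change (s \in `[a, b]); move: suv; rewrite !in_itv/= => /andP[h1 h2].
by apply/andP; split; lra.
Qed.

Lemma cutoff_exists (T : R) f (z0 : space3 R) : test_function f -> f z0 != 0 ->
  exists2 chi : space3 R -> R, smooth chi &
    forall z, (z.1.1 <= -1 -> chi z = 0) /\ (- 2^-1 <= z.1.1 <= T -> chi z = 1).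
Proof.
case: z0 => -[t0 a] b tf fz0; have [B B0 hB] := compact_box tf.2.
(* Squaring makes the profile nonnegative, so its integral cannot cancel to 0. *)
pose F := fun z => f z * f z.
have sF : smooth F := smoothM tf.1 tf.1.
have cF := smooth_continuous sF.
(* The map s -> k s + d carries ]-1, -1/2[ onto ]-(B + 1), B + 1[, so the rescaled profile [eta]
   vanishes outside ]-1, -1/2[. For -1/2 <= t <= T the window [t - L, t] contains [-1, -1/2], since
   T - L <= -1. *)
pose k := 4 * (B + 1); pose d := 3 * (B + 1); pose L := `|T| + 1.
have k0 : 0 < k by rewrite /k; lra.
pose eta (s : R) : R := F (k * s + d, a, b).
have ceta : continuous eta by rewrite /eta; cont.
have LT : T <= L - 1 by rewrite /L addrK ler_norm.
have L0 : 0 <= L by rewrite /L addr_ge0.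
have eta0 s : ~~ (-1 < s < - 2^-1) -> eta s = 0.
  move=> hs; rewrite /eta /F (@supp_eq0 _ f) ?mul0r// => /hB[/= h _ _].
  move: hs; apply/negP; rewrite negbK.
  move: h; rewrite /k /d ler_norml => /andP[h1 h2]; apply/andP; split; nra.
have E z : time_mean L k d a b F z = \int[mu]_(s in `[z.1.1 - L, z.1.1]) eta s.
  rewrite /time_mean; have cg : continuous (fun p => eta (z.1.1 - p)) by cont.
  rewrite -(@Rint_reflect _ (fun p => eta (z.1.1 - p)) z.1.1 L)//.
  by apply: eq_Rintegral => s _; rewrite subKr.
pose c := \int[mu]_(s in `[-1, - 2^-1]) eta s.
have c0 : 0 < c.
  apply: (@Rint_pos eta _ _ ((t0 - d) / k)) => //.
  - by move=> s; rewrite /eta /F -expr2 sqr_ge0.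
  - have /hB[/= h _ _] : supp f (t0, a, b) by apply: contrapT => /supp_eq0; exact/eqP.
    rewrite ltr_pdivlMr// ltr_pdivrMr// /k /d.
    by move: h; rewrite ler_norml => /andP[h1 h2]; apply/andP; split; lra.
  - by rewrite /eta mulrC divfK ?gt_eqF// subrK /F -expr2 exprn_even_gt0.
exists (fun z => c^-1 * time_mean L k d a b F z).
  exact: (smoothM (smooth_cst c^-1) (smooth_time_mean L k d a b sF)).
move=> z; rewrite E; split=> [hz|/andP[hz1 hz2]].
  rewrite (@eq_Rintegral _ _ _ _ _ (fun=> 0)) ?Rintegral_cst ?mul0r ?mulr0//.
  move=> s; rewrite inE/= in_itv/= => /andP[_ sz].
  by apply: eta0; rewrite negb_and -leNgt (le_trans sz hz).
rewrite (@Rint_support eta _ _ (-1) (- 2^-1))//; [by rewrite mulVf// gt_eqF|lra|].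
move=> s hs; apply: eta0; apply: contra hs => /andP[h1 h2].
by rewrite in_itv/= !ltW.
Qed.

End cutoff.

(** * The fundamental solution property and uniqueness *)

Section main.
Context {R : realType}.
Local Notation mu := (@lebesgue_measure R).
Implicit Types (f : space3 R -> R).

(** A nonzero integral forces the integrand to meet the support of [f] at some p, q, th, and the
    coordinates of that point bound t, y and x. The lower bound on t will come from the cutoff. *)
Lemma psi_supp_bound (B L : R) f (t y x : R) : 0 <= L ->
  (forall z, supp f z -> [/\ `|z.1.1| <= B, `|z.1.2| <= B & `|z.2| <= B]) ->
  psi L f (t, y, x) != 0 ->
  [/\ t <= B, `|y| <= B + L & `|x| <= B + L * (B + L) ^+ 3 + 1].
Proof.
move=> L0 hB nz.
have [p [q [th [pL qL sf]]]] : exists p q th, [/\ 0 <= p <= L, 0 <= q <= L &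
    supp f (t + (p + q) / 2, y - p, x + Num.sqrt (zf y p q) * sin th)].
  apply: contrapT => h; move: nz; rewrite /psi J000E /Rint2 => /eqP; apply.
  rewrite (@eq_Rintegral _ _ _ _ _ (fun=> 0)) ?Rintegral_cst ?mul0r ?mulr0//.
  move=> p; rewrite inE/= in_itv/= => hp.
  rewrite (@eq_Rintegral _ _ _ _ _ (fun=> 0)) ?Rintegral_cst ?mul0r ?mulr0//.
  move=> q; rewrite inE/= in_itv/= => hq; rewrite /Ker circE.
  rewrite (@eq_Rintegral _ _ _ _ _ (fun=> 0)) ?Rintegral_cst ?mul0r ?mulr0//.
  move=> th _; rewrite (@supp_eq0 _ f) ?mulr0// => hs.
  by apply: h; exists p, q, th.
have [/= h1 h2 h3] := hB _ sf.
move: pL qL => /andP[p0 pL] /andP[q0 qL].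
have yB : `|y| <= B + L.
  move: h2; rewrite !ler_norml => /andP[? ?]; apply/andP; split; lra.
split=> //.
  by move: h1; rewrite ler_norml => /andP[_]; lra.
set z := zf y p q in h3; have z0 : 0 <= z by exact: zf_ge0.
have zL : z <= L * (B + L) ^+ 3.
  have cube (u : R) : `|u| <= B + L -> `|u ^+ 3| <= (B + L) ^+ 3.
    by move=> h; rewrite normrX lerXn2r// nnegrE// (le_trans _ h).
  have hy := cube _ yB; have hyp : `|(y - p) ^+ 3| <= (B + L) ^+ 3.
    by apply: cube; rewrite (le_trans h2)// lerDl.
  have BL0 : 0 <= (B + L) ^+ 3 by rewrite (le_trans _ hy).
  have hz : (y ^+ 3 - (y - p) ^+ 3) / 3 <= (B + L) ^+ 3.
    by move: hy hyp; rewrite !ler_norml => /andP[_ hy] /andP[hyp _]; lra.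
  rewrite /z /zf (le_trans (ler_wpM2l q0 hz))//.
  by rewrite ler_wpM2r.
(* A crude bound without square roots suffices, as only compactness is at stake. *)
have rz : Num.sqrt z <= z + 1.
  have r0 := sqrtr_ge0 z; rewrite -{2}(sqr_sqrtr z0).
  by move: (Num.sqrt z) r0 => r r0; nra.
rewrite -(addrK (Num.sqrt z * sin th) x) (le_trans (ler_normB _ _))//.
rewrite -addrA lerD// normrM ger0_norm ?sqrtr_ge0//.
have : Num.sqrt z * `|sin th| <= Num.sqrt z * 1.
  by rewrite ler_wpM2l ?sqrtr_ge0// ler_norml sin_geN1 sin_le1.
by lra.
Qed.

Variable y1 : R.
Local Notation G := (regular_distribution (GammaF y1)).

Lemma regular_lin (a : R) f g : test_function f -> test_function g ->
  G (fun z => a * f z + g z) = a * G f + G g.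
Proof.
move=> [sf cf] [sg cg].
have i1 := GammaF_mul_integrable y1 (smooth_continuous sf) cf.
have i2 := GammaF_mul_integrable y1 (smooth_continuous sg) cg.
rewrite /regular_distribution -RintegralZl// -RintegralD//.
  by apply: eq_Rintegral => z _; ring.
rewrite [X in integrable _ _ X](_ : _ = (fun z => a%:E * (GammaF y1 z * f z)%:E)%E).
  exact: integrableZl.
by apply/funext => z; rewrite /= EFinM.
Qed.

(** The mass of Gamma on [K] serves as the constant, so the functional has order 0. *)
Lemma regular_bound (K : set (space3 R)) : compact K ->
  exists C, forall f (M : R), test_function f -> supp f `<=` K ->
    (forall z, `|f z| <= M) -> `|G f| <= C * M.
Proof.
move=> cK; have mK := measurable_compact3 cK.
have [mG iG] := GammaF_locally_integrable y1.
have iK : (@lebesgue3 R).-integrable K (EFin \o GammaF y1).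
  apply/integrableP; split; last exact: iG.
  by apply: measurable_funTS; apply/measurable_EFinP.
exists (\int[@lebesgue3 R]_(z in K) GammaF y1 z) => f M [sf cf] fK fM.
have i1 := GammaF_mul_integrable y1 (smooth_continuous sf) cf.
have iM : (@lebesgue3 R).-integrable K (EFin \o (fun z => M * GammaF y1 z)).
  rewrite [X in integrable _ _ X](_ : _ = (fun z => M%:E * (GammaF y1 z)%:E)%E).
    exact: integrableZl.
  by apply/funext => z; rewrite /= EFinM.
rewrite mulrC -RintegralZl//.
apply: (le_trans (le_normr_Rintegral _ i1)) => //.
rewrite [leRHS]Rintegral_mkcond; apply: le_Rintegral => //.
- have := integrable_abse i1; congr (integrable _ _ _).
- rewrite -restrict_EFin.
  have /iffLR h := @integrable_mkcond _ _ _ (@lebesgue3 R) _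
    (EFin \o (fun z => M * GammaF y1 z)) mK.
  exact: h iM.
- move=> z _; rewrite patchE normrM (ger0_norm (GammaF_ge0 _ _)) mulrC.
  case: ifPn => [_|]; first by rewrite ler_wpM2r ?GammaF_ge0.
  by rewrite notin_setE => zK; rewrite (@supp_eq0 _ f) ?normr0 ?mul0r// => /fK.
Qed.

Lemma regular_is_distribution : is_distribution G.
Proof.
split=> [|K /regular_bound[C hC]]; first exact: regular_lin.
exists C, 0%N => f M tf fK fM; apply: hC => // z.
exact: (fM [::]).
Qed.

Lemma regular_past f : supp f `<=` [set z | z.1.1 < 0] -> G f = 0.
Proof.
move=> hf; rewrite /regular_distribution (@eq_Rintegral _ _ _ _ _ (fun=> 0)).
  by rewrite Rintegral_cst// mul0r.
move=> z _; have [/hf/= z0|/supp_eq0 ->] := pselect (supp f z); last by rewrite mulr0.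
by rewrite /GammaF /Gamma (ltNge 0) (ltW z0) mul0r.
Qed.

Lemma regular_wave f : is_distribution G -> test_function f ->
  wave_op G f = dirac_delta (0, y1, 0) f.
Proof.
move=> dG tf; rewrite wave_op_adjoint//; have [sW cW] := test_wave tf.
have [T T0 vf] := supp_vanish tf.2.
have vW : vanish_after T (wave f).
  move=> z Tz; rewrite /wave.
  have v a b : vanish_after T (pd a (pd b f)) by do 2 apply: vanish_after_pd.
  by rewrite !v// !mulr0 !subr0.
have TL : T < (T + T + 1) / 2 by lra.
have L0 : 0 <= T + T + 1 by lra.
rewrite (regular_distribution_psi y1 (smooth_continuous sW) cW vW TL L0).
by apply: (psi_wave y1 0 L0 tf.1 vf); rewrite add0r.
Qed.

Lemma fundamental_unique (E : (space3 R -> R) -> R) f : fundamental_solution y1 E ->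
  test_function f -> E f = G f.
Proof.
move=> [dE pE wE] tf; have [linE _] := dE; have [sf cf] := tf.
(* The cutoff is built from [f] itself and needs a point where [f] is nonzero. The zero function has
   empty support and is covered by the vanishing clause. *)
have [[z0 fz0]|f0] := pselect (exists z, f z != 0); last first.
  have sf0 : supp f `<=` [set z | z.1.1 < 0].
    apply: (@subset_trans _ set0) => //; apply: supp_closed_sub; first exact: closed0.
    by move=> z _; apply: contrapT => fz; apply: f0; exists z; exact/eqP.
  by rewrite pE// regular_past.
have [B B0 hB] := compact_box cf.
have vf : vanish_after B f.
  move=> z Bz; apply: supp_eq0 => /hB[h _ _].
  by move: (lt_le_trans Bz (le_trans (ler_norm _) h)); rewrite ltxx.
(* Then B < t + L/2 for every t > -3, in particular wherever the cutoff equals 1 and [wave_psi] is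
   applied. *)
pose L := B + B + 6.
have L0 : 0 <= L by rewrite /L; lra.
have [chi schi hchi] := cutoff_exists B tf fz0.
have spsi : smooth (psi L f).
  exact: (smoothM (smooth_cst (4 * pi)^-1) (smooth_J L 0 0 0 sf)).
pose g := fun z => chi z * psi L f z.
(* The cutoff is controlled only up to time [B]; beyond it the potential itself vanishes. *)
have gE z : - 2^-1 <= z.1.1 -> g z = psi L f z.
  case: z => -[t y] x /= ht; rewrite /g.
  have [tB|tB] := leP t B.
    by rewrite (hchi (t, y, x)).2 ?mul1r//= ht.
  have [->|/(psi_supp_bound L0 hB)[]] := eqVneq (psi L f (t, y, x)) 0; first by rewrite mulr0.
  by rewrite leNgt tB.
(* One number dominating 1 and the bounds of [psi_supp_bound]; the 1 accounts for t >= -1 on the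
   support of the cutoff. *)
pose A := B + L * (B + L) ^+ 3 + 1 + (B + L + 1).
have tg : test_function g.
  split; first exact: (smoothM schi spsi).
  apply: (@compact_supp_sub _ _ ((`[- A, A] `*` `[- A, A]) `*` `[- A, A])).
    by apply: compact_setX; [apply: compact_setX|]; exact: segment_compact.
  case=> -[t y] x; apply: contra_notP => /eqP; rewrite /g mulf_eq0 negb_or => /andP[c0 p0].
  have [t1 hy hx] := psi_supp_bound L0 hB p0.
  have t2 : -1 <= t.
    by rewrite leNgt; apply: contra c0 => /ltW/(hchi (t, y, x)).1/eqP.
  have BL3 : 0 <= L * (B + L) ^+ 3 by rewrite mulr_ge0// exprn_ge0// addr_ge0// ltW.
  have [A1 [A2 A3]] : 1 <= A /\ (B + L <= A /\ B + L * (B + L) ^+ 3 + 1 <= A).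
    by move: BL3; rewrite /A; move: (L * _) => Z; split; [|split]; lra.
  split; [split|] => /=; rewrite in_itv/= -ler_norml; [|lra|lra].
  by rewrite ler_norml; apply/andP; split; lra.
have wg z : - 2^-1 < z.1.1 -> wave g z = f z.
  move=> hz; rewrite (@wave_near_eq _ g (psi L f)).
    case: z hz => -[t y] x /= hz; apply: (wave_psi y x L0 sf vf).
    by rewrite /L; lra.
  have ct : continuous (fun w : space3 R => w.1.1) by cont.
  have : nbhs z [set w : space3 R | - 2^-1 < w.1.1] by apply: (cvgr_gt _ (ct z)).
  by apply: filterS => w /= hw; apply: gE; exact: ltW.
have tw := test_wave tg.
have th := test_lin (-1) tf tw.
(* The difference vanishes for t > -1/2, so its closed support lies in t <= -1/2, inside the open
   half-space where E vanishes. *)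
have Eh : E (fun z => (-1) * f z + wave g z) = 0.
  apply: (pE _ th); apply: (@subset_trans _ [set w | w.1.1 <= - 2^-1]); last first.
    by move=> w /= hw; lra.
  apply: supp_closed_sub.
    have ct : continuous (fun w : space3 R => w.1.1) by cont.
    exact: (closed_comp (fun w _ => ct w) (@closed_le _ (- 2^-1))).
  by move=> z /negP; rewrite -ltNge => /wg ->; ring.
move: Eh; rewrite linE// mulN1r => /eqP; rewrite addrC subr_eq0 => /eqP <-.
rewrite -wave_op_adjoint// wE// /dirac_delta gE/=; last by lra.
by rewrite (regular_distribution_psi y1 (smooth_continuous sf) cf vf _ L0)// /L; lra.
Qed.

End main.

Unset Implicit Arguments.

Theorem proposition2p1 (R : realType) (y1 : R) :
  [/\ locally_integrable3 (GammaF y1),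
      forall t x1 x2 : R, t <= 0 -> Gamma t x1 y1 x2 = 0,
      fundamental_solution y1 (regular_distribution (GammaF y1)) &
      forall E : (space3 R -> R) -> R, fundamental_solution y1 E ->
        forall f, test_function f ->
          E f = regular_distribution (GammaF y1) f].
Proof.
split.
- exact: GammaF_locally_integrable.
- by move=> t x1 x2 t0; rewrite /Gamma ltNge t0.
- have dG := regular_is_distribution y1.
  split=> // f tf; [exact: regular_past|exact: regular_wave].
- by move=> E fE f tf; exact: fundamental_unique.
Qed.
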